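(* Let $G$ be a split semisimple simply connected group over $\mathbb{R}$ with a splitting $(T_0,B_0,\{X_\alpha\}_{\alpha\in\Delta})$, and let $A'\subset A$ be strongly orthogonal subsets of $R=R(T_0,G)$ consisting of positive roots. Then each element of the canonical set of isomorphisms $T_{A'}^{S_{A\setminus A'}}\to T_A$ induces (on cocharacter groups, by restriction) the same embedding $$i_{A',A}:X_*(T_{A'})_{-1}\hookrightarrow X_*(T_A)_{-1}.$$
   Context: Setting. $G$ is a split semisimple simply connected group over $\mathbb{R}$; $(T_0,B_0,\{X_\alpha\}_{\alpha\in\Delta})$ is a splitting: $T_0$ a split maximal torus, $B_0\supset T_0$ a Borel subgroup over $\mathbb{R}$, $0\ne X_\alpha\in\mathrm{Lie}(G)_\alpha(\mathbb{R})$ for each simple root $\alpha$. $R=R(T_0,G)$; $\alpha>0$ means $\alpha\in R(T_0,B_0)$; $\Delta$ is the set of simple roots; $\Omega=N(T_0)/T_0$; $\Gamma=\mathrm{Gal}(\mathbb{C}/\mathbb{R})=\{1,\sigma\}$. $\mathrm{Int}(g)h=ghg^{-1}$. For a nonzero $X\in\mathrm{Lie}(G)_\gamma$, $\gamma\in R$, let $X_{-}\in\mathrm{Lie}(G)_{-\gamma}$ be the unique element such that $(d\gamma^\vee(1),X,X_-)$ is an $\mathfrak{sl}_2$-triple (for $X=X_\alpha$ write $X_-=X_{-\alpha}$). For $\alpha\in\Delta$, $n_\alpha=\exp(X_\alpha)\exp(-X_{-\alpha})\exp(X_\alpha)$; for $\mu\in\Omega$ with reduced expression $\mu=s_{\alpha_1}\cdots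 s_{\alpha_q}$, $n(\mu)=n_{\alpha_1}\cdots n_{\alpha_q}$. For $\mu\in\Omega,\alpha\in\Delta$, $X_{\mu|\alpha}=\mathrm{Int}(n(\mu))X_\alpha$. For $\alpha>0$ and $\mu\in\Omega$ with $\mu^{-1}\alpha\in\Delta$, put $g_{\mu,\alpha}=\exp\left(\frac{i\pi}{4}(X+X_-)\right)$ with $X=X_{\mu|\mu^{-1}\alpha}$. Roots $\alpha,\beta$ with $\beta\neq\pm\alpha$ are strongly orthogonal if $\alpha+\beta\notin R$ and $\alpha-\beta\notin R$; a strongly orthogonal subset (SOS) is a subset of $R$ whose distinct elements are pairwise strongly orthogonal. For an SOS $A$, $S_A=\prod_{\alpha\in A}s_\alpha\in\Omega$. For an SOS $A$ of positive roots, all elements $g=\prod_{\alpha\in A}g_{\mu_\alpha,\alpha}$ (with $\mu_\alpha\in\Omega$, $\mu_\alpha^{-1}\alpha\in\Delta$; the factors commute) give the same torus $T_A:=\mathrm{Int}(g)T_0$, which is defined over $\mathbb{R}$; the maps $\mathrm{Int}(g)|_{T_0}$ are isomorphisms of real tori $T_0^{S_A}\to T_A$, where $T_0^{S_A}$ is $T_0$ with $\sigma$ acting by $S_A\circ\sigma$. For $A'\subset A$, the canonical set of isomorphisms $T_{A'}^{S_{A\setminus A'}}\to T_A$ is $$\left\{\mathrm{Int}(g)|_{T_{A'}}\ :\ g=\prod_{\alpha\in A\setminus A'}g_{\mu_\alpha,\alpha},\ \mu_\alpha\in\Omega,\ \mu_\alpha^{-1}\alpha\in\Delta\right\},$$ where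 $T_{A'}^{S_{A\setminus A'}}$ is $T_{A'}$ with Galois action twisted by $S_{A\setminus A'}$ (transported to $T_{A'}$ via any of the isomorphisms $T_0^{S_{A'}}\to T_{A'}$). For a maximal torus $T$ over $\mathbb{R}$, with $\sigma_T$ the action of $\sigma$ on $X_*(T)$, $X_*(T)_{-1}=\{\lambda\in X_*(T):\sigma_T(\lambda)=-\lambda\}$. *)

(* Defs.v *)
From HB Require Import structures.
From mathcomp Require Import all_boot all_order all_algebra.
From mathcomp Require Import complex.
From mathcomp Require Import all_classical all_reals all_analysis.
From mathcomp Require mpoly.

Set Implicit Arguments.
Unset Strict Implicit.
Unset Printing Implicit Defensive.

Import Order.TTheory GRing.Theory Num.Theory.
Import numFieldNormedType.Exports.

Local Open Scope classical_set_scope.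
Local Open Scope ring_scope.

(* F : realType is the field of real numbers and
   F[i] the field of complex numbers.

   A linear algebraic group is given by its group of complex points, a
   Zariski-closed subgroup of GL_n(C); it is over R when it is cut out by
   polynomials with real coefficients, and sigma then acts on its points by
   complex conjugation of the entries.  Characteristic 0 makes every algebraic
   group reduced, so nothing is lost. *)

Definition ev (F : realType) n (f : mpoly.mpoly (n * n) F[i])
    (A : 'M[F[i]]_n) : F[i] :=
  mpoly.meval (fun i => mxvec A 0 i) f.

(* K is the field of coefficients, embedded in the complex numbers by iota:
   it is used with K = F[i], iota = idfun and with K = F,
   iota = real_complex F. *)
Definition zclosed (F : realType) (K : comNzRingType)
    (iota : {rmorphism K -> F[i]}) n (Z : set 'M[F[i]]_n) : Prop :=
  exists S : set (mpoly.mpoly (n * n) K),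
    Z = [set A | A \in unitmx /\
                 forall f, S f -> ev (mpoly.map_mpoly iota f) A = 0].

(* Regular functions on GL_n are the p / det^k. *)
Definition regular_on (F : realType) (K : comNzRingType)
    (iota : {rmorphism K -> F[i]}) n (D : set 'M[F[i]]_n)
    (f : 'M[F[i]]_n -> F[i]) : Prop :=
  exists k (p : mpoly.mpoly (n * n) K),
    forall A, D A -> f A = ev (mpoly.map_mpoly iota p) A / (\det A) ^+ k.

Definition is_subgroup (F : realType) n (G : set 'M[F[i]]_n) : Prop :=
  [/\ G `<=` [set A | A \in unitmx], G 1%:M,
      forall A B, G A -> G B -> G (A *m B) & forall A, G A -> G (invmx A)].

Definition alg_group (F : realType) (K : comNzRingType)
    (iota : {rmorphism K -> F[i]}) n (G : set 'M[F[i]]_n) : Prop :=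
  zclosed iota G /\ is_subgroup G.

Definition alg_group_C (F : realType) n (G : set 'M[F[i]]_n) : Prop :=
  alg_group (idfun : {rmorphism F[i] -> F[i]}) G.

Definition alg_group_R (F : realType) n (G : set 'M[F[i]]_n) : Prop :=
  alg_group (real_complex F : {rmorphism F -> F[i]}) G.

Definition alg_morph (F : realType) (K : comNzRingType)
    (iota : {rmorphism K -> F[i]}) m n
    (H : set 'M[F[i]]_m) (G : set 'M[F[i]]_n)
    (phi : 'M[F[i]]_m -> 'M[F[i]]_n) : Prop :=
  [/\ forall A, H A -> G (phi A),
      forall A B, H A -> H B -> phi (A *m B) = phi A *m phi B &
      forall i j, regular_on iota H (fun A => phi A i j)].

Definition alg_iso (F : realType) (K : comNzRingType)
    (iota : {rmorphism K -> F[i]}) m n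
    (H : set 'M[F[i]]_m) (G : set 'M[F[i]]_n)
    (phi : 'M[F[i]]_m -> 'M[F[i]]_n) : Prop :=
  alg_morph iota H G phi /\
  exists psi, [/\ alg_morph iota G H psi,
                  forall A, H A -> psi (phi A) = A &
                  forall B, G B -> phi (psi B) = B].

Definition zconnected (F : realType) n (G : set 'M[F[i]]_n) : Prop :=
  forall Z1 Z2 : set 'M[F[i]]_n,
    zclosed (idfun : {rmorphism F[i] -> F[i]}) Z1 ->
    zclosed (idfun : {rmorphism F[i] -> F[i]}) Z2 ->
    G `<=` Z1 `|` Z2 -> G `&` Z1 `&` Z2 = set0 -> G `<=` Z1 \/ G `<=` Z2.

Definition derived_subgroup (F : realType) n (G : set 'M[F[i]]_n) :
    set 'M[F[i]]_n :=
  \bigcap_(H in [set H | is_subgroup H /\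
                   forall A B, G A -> G B ->
                     H (A *m B *m invmx A *m invmx B)]) H.

Definition is_solvable (F : realType) n (G : set 'M[F[i]]_n) : Prop :=
  exists k, iter k (@derived_subgroup F n) G = [set 1%:M].

Definition is_normal_in (F : realType) n (H G : set 'M[F[i]]_n) : Prop :=
  H `<=` G /\ forall g h, G g -> H h -> H (g *m h *m invmx g).

(* Connected with trivial radical. *)
Definition is_semisimple (F : realType) n (G : set 'M[F[i]]_n) : Prop :=
  zconnected G /\
  forall H, alg_group_C H -> zconnected H -> is_normal_in H G ->
    is_solvable H -> H = [set 1%:M].

(* Every isogeny from a connected group onto G is an isomorphism. *)
Definition is_simply_connected (F : realType) n (G : set 'M[F[i]]_n) : Prop :=
  forall m (H : set 'M[F[i]]_m) (phi : 'M[F[i]]_m -> 'M[F[i]]_n),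
    alg_group_C H -> zconnected H ->
    alg_morph (idfun : {rmorphism F[i] -> F[i]}) H G phi ->
    phi @` H = G -> finite_set [set A | H A /\ phi A = 1%:M] ->
    alg_iso (idfun : {rmorphism F[i] -> F[i]}) H G phi.

Definition diag_group (F : realType) r : set 'M[F[i]]_r :=
  [set A | A \in unitmx /\ is_diag_mx A].
Arguments diag_group : clear implicits.

Definition is_torus (F : realType) n (T : set 'M[F[i]]_n) : Prop :=
  alg_group_C T /\
  exists r phi,
    alg_iso (idfun : {rmorphism F[i] -> F[i]}) (diag_group F r) T phi.

Definition is_split_torus (F : realType) n (T : set 'M[F[i]]_n) : Prop :=
  alg_group_R T /\
  exists r phi,
    alg_iso (real_complex F : {rmorphism F -> F[i]}) (diag_group F r) T phi.

Definition is_maximal_torus (F : realType) n (G T : set 'M[F[i]]_n) : Prop :=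
  [/\ is_torus T, T `<=` G &
      forall T1, is_torus T1 -> T1 `<=` G -> T `<=` T1 -> T1 = T].

Definition is_borel_R (F : realType) n (G B : set 'M[F[i]]_n) : Prop :=
  [/\ alg_group_R B, B `<=` G, zconnected B, is_solvable B &
      forall B1, alg_group_C B1 -> B1 `<=` G -> zconnected B1 ->
        is_solvable B1 -> B `<=` B1 -> B1 = B].

Definition Int (F : realType) n (g h : 'M[F[i]]_n) : 'M[F[i]]_n :=
  g *m h *m invmx g.

Definition conjM (F : realType) n (A : 'M[F[i]]_n) : 'M[F[i]]_n :=
  map_mx conjc A.

Definition bracket (F : realType) n (X Y : 'M[F[i]]_n) : 'M[F[i]]_n :=
  X *m Y - Y *m X.

(* The tangent space at 1: the X at which the differential at 1 of every
   polynomial vanishing on G vanishes. *)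
Definition Lie (F : realType) n (G : set 'M[F[i]]_n) : set 'M[F[i]]_n :=
  [set X | forall f : mpoly.mpoly (n * n) F[i],
     (forall A, G A -> ev f A = 0) ->
     \sum_(i < n * n) mxvec X 0 i * ev (mpoly.mderiv i f) 1%:M = 0].

Definition expM (F : realType) n (X : 'M[F[i]]_n) : 'M[F[i]]_n :=
  limn (series (fun k : nat => (k`!%:R)^-1 *: X ^+ k)).

(* A cocharacter is a function on F[i] sending 0 to the zero matrix, which is
   never in T: it is determined by its values on the invertible elements, so
   that equality of functions is equality of cocharacters.  The entries are
   Laurent polynomials. *)
Definition cochar (F : realType) n (T : set 'M[F[i]]_n) :
    set (F[i] -> 'M[F[i]]_n) :=
  [set l | [/\ l 0 = 0, forall z, z != 0 -> T (l z),
               forall z w, z != 0 -> w != 0 -> l (z * w) = l z *m l w &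
               exists k (P : 'M[{poly F[i]}]_n),
                 forall z, z != 0 ->
                   l z = z ^- k *: map_mx (fun p : {poly F[i]} => p.[z]) P]].

Definition cochar_add (F : realType) n (l1 l2 : F[i] -> 'M[F[i]]_n) :
    F[i] -> 'M[F[i]]_n := fun z => l1 z *m l2 z.

Definition cochar_opp (F : realType) n (l : F[i] -> 'M[F[i]]_n) :
    F[i] -> 'M[F[i]]_n := fun z => invmx (l z).

Definition cochar_sigma (F : realType) n (l : F[i] -> 'M[F[i]]_n) :
    F[i] -> 'M[F[i]]_n := fun z => conjM (l (conjc z)).

(* X_*(T)_{-1} *)
Definition cochar_m1 (F : realType) n (T : set 'M[F[i]]_n) :
    set (F[i] -> 'M[F[i]]_n) :=
  [set l | cochar T l /\ cochar_sigma l = cochar_opp l].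

(* H = dl(1), the derivative of z^(-k) P(z) at z = 1. *)
Definition is_dcochar (F : realType) n (l : F[i] -> 'M[F[i]]_n)
    (H : 'M[F[i]]_n) : Prop :=
  exists k (P : 'M[{poly F[i]}]_n),
    (forall z, z != 0 ->
       l z = z ^- k *: map_mx (fun p : {poly F[i]} => p.[z]) P) /\
    H = map_mx (fun p : {poly F[i]} => p^`().[1]) P
        - k%:R *: map_mx (fun p : {poly F[i]} => p.[1]) P.

(* A character of T is extended by 0 outside T, so that equality of functions
   is equality of characters.  The group law of X^*(T), written additively in
   the literature, is the pointwise product. *)
Definition character (F : realType) n (T : set 'M[F[i]]_n) :
    set ('M[F[i]]_n -> F[i]) :=
  [set c | [/\ forall t, ~ T t -> c t = 0, forall t, T t -> c t != 0,
               forall t u, T t -> T u -> c (t *m u) = c t * c u &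
               regular_on (idfun : {rmorphism F[i] -> F[i]}) T c]].

Definition char_add (F : realType) n (a b : 'M[F[i]]_n -> F[i]) :
    'M[F[i]]_n -> F[i] := fun t => a t * b t.

Definition char_opp (F : realType) n (a : 'M[F[i]]_n -> F[i]) :
    'M[F[i]]_n -> F[i] := fun t => (a t)^-1.

Definition weight_space (F : realType) n (H T0 : set 'M[F[i]]_n)
    (c : 'M[F[i]]_n -> F[i]) : set 'M[F[i]]_n :=
  [set X | Lie H X /\ forall t, T0 t -> Int t X = c t *: X].

(* R(T0, H), for H = G or a Borel subgroup. *)
Definition root_set (F : realType) n (H T0 : set 'M[F[i]]_n) :
    set ('M[F[i]]_n -> F[i]) :=
  [set c | [/\ character T0 c, exists2 t, T0 t & c t != 1 &
               exists2 X, X != 0 & weight_space H T0 c X]].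

Definition simple_roots (F : realType) n (B0 T0 : set 'M[F[i]]_n) :
    set ('M[F[i]]_n -> F[i]) :=
  [set c | root_set B0 T0 c /\
     ~ exists a b, [/\ root_set B0 T0 a, root_set B0 T0 b & c = char_add a b]].

Definition normaliser (F : realType) n (G T0 : set 'M[F[i]]_n) :
    set 'M[F[i]]_n :=
  [set m | G m /\ Int m @` T0 = T0].

(* The elements of Omega = N(T0)/T0 are the cosets m T0. *)
Definition weyl_group (F : realType) n (G T0 : set 'M[F[i]]_n) :
    set (set 'M[F[i]]_n) :=
  [set mu | exists2 m, normaliser G T0 m & mu = [set m *m t | t in T0]].

Definition coset_mul (F : realType) n (mu nu : set 'M[F[i]]_n) :
    set 'M[F[i]]_n := [set x *m y | x in mu & y in nu].

(* b = mu a, for the action of Omega on characters. *)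
Definition weyl_sends (F : realType) n (mu : set 'M[F[i]]_n)
    (a b : 'M[F[i]]_n -> F[i]) : Prop :=
  exists2 m, mu m & b = (fun t => a (Int (invmx m) t)).

(* m induces on T0 the map t |-> t l(c(t))^-1, that is, the reflection
   x |-> x - <c, x> l of X_*(T0). *)
Definition acts_as_reflection (F : realType) n (G T0 : set 'M[F[i]]_n)
    (c : 'M[F[i]]_n -> F[i]) (l : F[i] -> 'M[F[i]]_n) (m : 'M[F[i]]_n) :
    Prop :=
  normaliser G T0 m /\ forall t, T0 t -> Int m t = t *m invmx (l (c t)).

(* The coroot of c is the unique cocharacter l with <c, l> = 2 such that the
   corresponding reflection is induced by an element of Omega. *)
Definition is_coroot (F : realType) n (G T0 : set 'M[F[i]]_n)
    (c : 'M[F[i]]_n -> F[i]) (l : F[i] -> 'M[F[i]]_n) : Prop :=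
  [/\ cochar T0 l, forall z, z != 0 -> c (l z) = z ^+ 2 &
      exists m, acts_as_reflection G T0 c l m].

(* s_c, as a coset of T0 *)
Definition weyl_refl (F : realType) n (G T0 : set 'M[F[i]]_n)
    (c : 'M[F[i]]_n -> F[i]) : set 'M[F[i]]_n :=
  [set m | exists2 l, is_coroot G T0 c l & acts_as_reflection G T0 c l m].

Definition word_prod (F : realType) n (G T0 : set 'M[F[i]]_n)
    (w : seq ('M[F[i]]_n -> F[i])) : set 'M[F[i]]_n :=
  foldr (fun c mu => coset_mul (weyl_refl G T0 c) mu) T0 w.

Definition reduced_expression (F : realType) n (G B0 T0 : set 'M[F[i]]_n)
    (mu : set 'M[F[i]]_n) (w : seq ('M[F[i]]_n -> F[i])) : Prop :=
  [/\ forall c, c \in w -> simple_roots B0 T0 c, word_prod G T0 w = mu &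
      forall w', (forall c, c \in w' -> simple_roots B0 T0 c) ->
        word_prod G T0 w' = mu -> (size w <= size w')%N].

(* Y = X_-, for X a nonzero element of Lie(G)_c.  The elements X_-, n(mu) and
   g_{mu,a}, each unique, are specified by relations. *)
Definition is_opposite (F : realType) n (G T0 : set 'M[F[i]]_n)
    (c : 'M[F[i]]_n -> F[i]) (X Y : 'M[F[i]]_n) : Prop :=
  [/\ root_set G T0 c, weight_space G T0 c X, X != 0,
      weight_space G T0 (char_opp c) Y &
      exists l H, [/\ is_coroot G T0 c l, is_dcochar l H,
        bracket H X = 2%:R *: X, bracket H Y = - (2%:R *: Y) &
        bracket X Y = H]].

Definition is_splitting (F : realType) n (G B0 T0 : set 'M[F[i]]_n)
    (Xs : ('M[F[i]]_n -> F[i]) -> 'M[F[i]]_n) : Prop :=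
  [/\ is_maximal_torus G T0, is_split_torus T0, is_borel_R G B0, T0 `<=` B0 &
      forall c, simple_roots B0 T0 c ->
        [/\ weight_space G T0 c (Xs c), conjM (Xs c) = Xs c & Xs c != 0]].

Definition is_n (F : realType) n (G B0 T0 : set 'M[F[i]]_n)
    (Xs : ('M[F[i]]_n -> F[i]) -> 'M[F[i]]_n)
    (mu : set 'M[F[i]]_n) (m : 'M[F[i]]_n) : Prop :=
  exists w (Ys : ('M[F[i]]_n -> F[i]) -> 'M[F[i]]_n),
    [/\ reduced_expression G B0 T0 mu w,
        forall c, c \in w -> is_opposite G T0 c (Xs c) (Ys c) &
        m = \prod_(c <- w) (expM (Xs c) *m expM (- Ys c) *m expM (Xs c))].

(* g = g_{mu,a}; here X = X_{mu|a'} with a' = mu^-1 a. *)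
Definition is_g (F : realType) n (G B0 T0 : set 'M[F[i]]_n)
    (Xs : ('M[F[i]]_n -> F[i]) -> 'M[F[i]]_n)
    (mu : set 'M[F[i]]_n) (a : 'M[F[i]]_n -> F[i]) (g : 'M[F[i]]_n) : Prop :=
  weyl_group G T0 mu /\
  exists a' m X Y,
    [/\ simple_roots B0 T0 a' /\ weyl_sends mu a' a,
        is_n G B0 T0 Xs mu m, X = Int m (Xs a'), is_opposite G T0 a X Y &
        g = expM (((pi / 4%:R : F)%:C * 'i)%C *: (X + Y))].

Definition strongly_orthogonal (F : realType) n (G T0 : set 'M[F[i]]_n)
    (a b : 'M[F[i]]_n -> F[i]) : Prop :=
  [/\ b <> a, b <> char_opp a, ~ root_set G T0 (char_add a b) &
      ~ root_set G T0 (char_add a (char_opp b))].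

Definition is_SOS (F : realType) n (G T0 : set 'M[F[i]]_n)
    (A : set ('M[F[i]]_n -> F[i])) : Prop :=
  A `<=` root_set G T0 /\
  forall a b, A a -> A b -> a <> b -> strongly_orthogonal G T0 a b.

(* g is a product of elements g_{mu_a,a} over a in A.  The factors commute, so
   the order of the enumeration s of the finite set A is irrelevant. *)
Definition is_g_prod (F : realType) n (G B0 T0 : set 'M[F[i]]_n)
    (Xs : ('M[F[i]]_n -> F[i]) -> 'M[F[i]]_n)
    (A : set ('M[F[i]]_n -> F[i])) (g : 'M[F[i]]_n) : Prop :=
  exists (s : seq ('M[F[i]]_n -> F[i]))
         (mus : ('M[F[i]]_n -> F[i]) -> set 'M[F[i]]_n)
         (gs : ('M[F[i]]_n -> F[i]) -> 'M[F[i]]_n),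
    [/\ uniq s, A = [set a | a \in s],
        forall a, A a -> is_g G B0 T0 Xs (mus a) a (gs a) &
        g = \prod_(a <- s) gs a].

(* T = T_A: the common value of Int(g) T0 for all the products g of the
   previous definition. *)
Definition is_T (F : realType) n (G B0 T0 : set 'M[F[i]]_n)
    (Xs : ('M[F[i]]_n -> F[i]) -> 'M[F[i]]_n)
    (A : set ('M[F[i]]_n -> F[i])) (T : set 'M[F[i]]_n) : Prop :=
  (exists g, is_g_prod G B0 T0 Xs A g) /\
  forall g, is_g_prod G B0 T0 Xs A g -> T = Int g @` T0.

(* The canonical set of isomorphisms from T' = T_{A'} to T_A; only the values
   of phi on T' are constrained.  The twist of the Galois action on the source
   does not change its points. *)
Definition canonical_isos (F : realType) n (G B0 T0 : set 'M[F[i]]_n)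
    (Xs : ('M[F[i]]_n -> F[i]) -> 'M[F[i]]_n)
    (A' A : set ('M[F[i]]_n -> F[i])) (T' : set 'M[F[i]]_n) :
    set ('M[F[i]]_n -> 'M[F[i]]_n) :=
  [set phi | exists2 g, is_g_prod G B0 T0 Xs (A `\` A') g &
                        forall t, T' t -> phi t = Int g t].

(* Main.v *)
(* The common embedding is the inclusion.  Write a cocharacter l of T_{A'} with
   sigma(l) = - l as Int(g') l0, with g' a product of the g_{mu,b}, b in A', and
   l0 a cocharacter of the split torus T_0.  Let a be in A \ A' and X in the root
   space of a.  By strong orthogonality the root vectors of +-a commute with
   those of +-b, hence X commutes with g' and with its complex conjugate.  Since
   a and l0 are defined over R, the equation sigma(l) = - l acting on X gives
   <a, l0> = - <a, l0>, so l0 commutes with the root vectors of +-a.  Therefore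
   every product of elements g_{mu,a}, a in A \ A', commutes both with l0 and
   with g', and conjugation by it fixes l.  The same fact shows that l takes its
   values in T_A = Int(g' g'') T_0. *)

Require Import Defs.
From HB Require Import structures.
From mathcomp Require Import all_boot all_order all_algebra.
From mathcomp Require Import complex.
From mathcomp Require Import all_classical all_reals all_analysis.
From mathcomp Require Import perm ring lra.
From mathcomp Require Import (canonicals) mpoly.
Import Order.TTheory GRing.Theory Num.Theory.
Import numFieldNormedType.Exports.
Local Open Scope classical_set_scope.
Local Open Scope ring_scope.
Set Implicit Arguments.
Unset Strict Implicit.
Unset Printing Implicit Defensive.

(** * Matrix exponential *)

(** Several facts that structure theory would supply are proved by hand. Strong orthogonality speaks
    of a + b and a - b, not of -a - b, and the symmetry of the set of roots is not at hand. So <b,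
    a^vee> = 0 is derived first, from the fact that [X_a, X_-a] = da^vee(1) commutes with X_b; a
    representative of s_a then carries the weight -a - b to a - b. That a root is defined over R
    comes from the generation of T_0 by coordinate cocharacters over R, on each of which the root is
    an integral power. The pairing <a, l> is never formed as an integer: it appears as natural
    numbers i, j with z^i = a(l z) z^j, and i = j is tested at z = 2, a real number with distinct
    powers. Two properties of the exponential enter: exp X is invertible, and it commutes with every
    matrix that commutes with X. They apply alike to every g_{mu,a}, whence the independence of
    mu. *)

Definition exp_poly (F : realType) (a : F) (N : nat) : {poly F} :=
  \poly_(k < N) (a ^+ k / k`!%:R).

Lemma coef_exp_polyM (F : realType) (a b : F) (N k : nat) : (k < N)%N ->
  (exp_poly a N * exp_poly b N)`_k = (a + b) ^+ k / k`!%:R.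
Proof.
move=> kN; rewrite coefMr exprDn big_distrl /=; apply: eq_bigr => i _.
have ik : (i <= k)%N by rewrite -ltnS.
rewrite !coef_poly (leq_ltn_trans ik kN) (leq_ltn_trans (leq_subr _ _) kN).
have f0 m : (m`!%:R : F) != 0 by rewrite pnatr_eq0 -lt0n fact_gt0.
rewrite -[in RHS](bin_fact ik) !natrM -mulr_natr.
have C0 : ('C(k, i)%:R : F) != 0 by rewrite pnatr_eq0 -lt0n bin_gt0.
by field; rewrite C0 !f0.
Qed.

Lemma horner_exp_poly (F : realType) (a c : F) (N : nat) :
  (exp_poly a N).[c] = series (exp_coeff (a * c)) N.
Proof.
rewrite horner_poly /series /= big_mkord; apply: eq_bigr => k _.
by rewrite /exp_coeff /= exprMn mulrAC.
Qed.

(** Dropping the signs of exp(-x) leaves the nonnegative coefficients of a truncated exp(x)^2, whose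
    tail is controlled by the real exponential. *)
Lemma norm_coef_exp_polyM_le (F : realType) (N k : nat) :
  `|(exp_poly (1 : F) N * exp_poly (-1) N)`_k|
    <= (exp_poly (1 : F) N * exp_poly 1 N)`_k.
Proof.
rewrite !coefM (le_trans (ler_norm_sum _ _ _))//; apply: ler_sum => i _.
rewrite normrM !coef_poly.
do 2! case: ifP => _; rewrite ?normr0 ?mulr0 ?mul0r//.
by rewrite !normrM !normfV !normrX normrN1 !expr1n normr1 !normr_nat !expr1n !mul1r.
Qed.

Lemma entry_expr_le (F : realType) (n : nat) (X : 'M[F[i]]_n) :
  exists2 c : F, 0 <= c & forall k i j, `|(X ^+ k) i j| <= (c ^+ k)%:C%C.
Proof.
pose s := \sum_i \sum_j `|X i j|.
have s0 : 0 <= s by apply: sumr_ge0 => i _; apply: sumr_ge0.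
have sE : (complex.Re s)%:C%C = s by rewrite RRe_real ?ger0_real.
exists (complex.Re s); first by rewrite -lecR sE.
(* Row sums make the induction close; a bound on single entries would not. *)
have H k i : \sum_j `|(X ^+ k) i j| <= s ^+ k.
  elim: k i => [|k IH] i.
    rewrite expr0 (bigD1 i) //= big1 ?addr0 => [|j /negbTE ji].
      by rewrite mxE eqxx normr1.
    by rewrite mxE eq_sym ji normr0.
  rewrite exprS; apply: (@le_trans _ _ (\sum_l `|X i l| * s ^+ k)); last first.
    rewrite -mulr_suml exprS ler_wpM2r ?exprn_ge0//.
    rewrite [leRHS](bigD1 i) //= lerDl; apply: sumr_ge0 => l _; exact: sumr_ge0.
  apply: (@le_trans _ _ (\sum_j \sum_l `|X i l| * `|(X ^+ k) l j|)).
    apply: ler_sum => j _; rewrite mxE (le_trans (ler_norm_sum _ _ _))//.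
    by apply: ler_sum => l _; rewrite normrM.
  rewrite exchange_big /=; apply: ler_sum => l _.
  by rewrite -mulr_sumr ler_wpM2l.
move=> k i j; rewrite rmorphXn /= sE (le_trans _ (H k i))//.
by rewrite (bigD1 j) //= lerDl; apply: sumr_ge0.
Qed.

Lemma cvg_real_complex (F : realType) (u : nat -> F) (x : F) :
  u @ \oo --> x ->
  (fun k => (u k)%:C%C : (F[i] : numFieldType)) @ \oo
    --> (x%:C%C : (F[i] : numFieldType)).
Proof.
move/cvgrPdist_lt => ux; apply/cvgrPdist_lt => e e0.
have eE : (complex.Re e)%:C%C = e by rewrite RRe_real ?gtr0_real.
have re0 : 0 < complex.Re e by rewrite -ltcR eE.
near=> k.
rewrite -rmorphB /= normc_def /= expr0n /= addr0 sqrtr_sqr -eE ltcR.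
near: k; exact: ux.
Unshelve. all: by end_near. Qed.

Lemma cvg_mxP (K : numFieldType) (m n : nat) (u : nat -> 'M[K]_(m, n))
    (A : 'M[K]_(m, n)) :
  u @ \oo --> A <-> forall i j, (fun k => u k i j) @ \oo --> A i j.
Proof.
split=> [uA i j|uA].
  apply/cvgrPdist_lt => e e0; near=> k.
  have : ball A e (u k) by near: k; apply: cvg_ball.
  by case=> _ /(_ i j); rewrite -ball_normE.
move=> B [P AP PB]; rewrite /nbhs /=.
suff : \forall k \near \oo, forall i j, P i j (u k i j).
  by apply: filterS => k; exact: PB.
apply: filter_forall => i; apply: filter_forall => j.
exact: uA (AP i j).
Unshelve. all: by end_near. Qed.

Lemma cvg_mulmx (K : numFieldType) (n : nat) (u v : nat -> 'M[K]_n)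
    (A B : 'M[K]_n) :
  u @ \oo --> A -> v @ \oo --> B -> (fun k => u k *m v k) @ \oo --> A *m B.
Proof.
move=> /cvg_mxP uA /cvg_mxP vB; apply/cvg_mxP => i j.
rewrite mxE (_ : (fun k => _) = fun k => \sum_l u k i l * v k l j); last first.
  by apply/funext => k; rewrite mxE.
apply: cvg_big => [|l _]; [exact: add_continuous|exact: cvgM].
Qed.

(** [limn] takes a default value on divergent sequences, so convergence precedes every use of
    [expM]. The real and imaginary parts of each entry converge absolutely, being dominated by the
    exponential series of c. *)
Lemma cvg_expM (F : realType) (n : nat) (X : 'M[F[i]]_n) :
  series (fun k : nat => (k`!%:R)^-1 *: X ^+ k) @ \oo
    --> (expM X : 'M[(F[i] : numFieldType)]_n).
Proof.
have [c c0 cX] := entry_expr_le X.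
pose x k i j : F[i] := (k`!%:R)^-1 * (X ^+ k) i j.
have f0 k : 0 <= (k`!%:R : F)^-1 by rewrite invr_ge0.
have xle k i j : `|x k i j| <= (exp_coeff c k)%:C%C.
  rewrite normrM normfV normr_nat /exp_coeff /= mulrC.
  rewrite rmorphM fmorphV rmorph_nat ler_wpM2r ?invr_ge0 //.
have cvR (f : F[i] -> F) i j : (forall z, (`|f z|)%:C%C <= `|z|) ->
    cvgn (series (fun k => f (x k i j))).
  move=> fz; apply: normed_cvg.
  apply: series_le_cvg; last exact: (is_cvg_series_exp_coeff c).
  - by move=> k /=.
  - by move=> k; rewrite /exp_coeff /= mulr_ge0 ?exprn_ge0.
  by move=> k /=; rewrite -lecR (le_trans (fz _) (xle _ _ _)).
have leRe z : (`|complex.Re z|)%:C%C <= `|z :> F[i]|.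
  rewrite normc_def lecR -[leLHS]sqrtr_sqr.
  by rewrite ler_wsqrtr// lerDl sqr_ge0.
have leIm z : (`|complex.Im z|)%:C%C <= `|z :> F[i]|.
  rewrite normc_def lecR -[leLHS]sqrtr_sqr.
  by rewrite ler_wsqrtr// lerDr sqr_ge0.
pose L : 'M[F[i]]_n := \matrix_(i, j)
  ((limn (series (fun k => complex.Re (x k i j))))%:C
   + 'i * (limn (series (fun k => complex.Im (x k i j))))%:C)%C.
suff SL : series (fun k : nat => (k`!%:R)^-1 *: X ^+ k) @ \oo
    --> (L : 'M[(F[i] : numFieldType)]_n).
  by rewrite /expM (cvg_lim _ SL)//; exact: norm_hausdorff.
apply/cvg_mxP => i j; rewrite mxE.
rewrite (_ : (fun k => _) = fun N =>
   ((series (fun k => complex.Re (x k i j)) N)%:C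
   + 'i * (series (fun k => complex.Im (x k i j)) N)%:C)%C); last first.
  apply/funext => N; rewrite /series /= summxE !rmorph_sum /= mulr_sumr -big_split /=.
  by apply: eq_bigr => k _; rewrite mxE -complexE.
apply: cvgD; first by apply: cvg_real_complex; exact: cvR.
by apply: cvgMr; apply: cvg_real_complex; exact: cvR.
Qed.

Lemma cvg_mx_unique (K : numFieldType) (m n : nat) (u : nat -> 'M[K]_(m, n))
    (A B : 'M[K]_(m, n)) : u @ \oo --> A -> u @ \oo --> B -> A = B.
Proof. by move=> uA uB; apply: (cvg_unique _ uA uB); exact: norm_hausdorff. Qed.

Lemma expM_comm (F : realType) (n : nat) (X M : 'M[F[i]]_n) :
  M *m X = X *m M -> M *m expM X = expM X *m M.
Proof.
move=> MX.
apply: (@cvg_mx_unique _ _ _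
  (fun N => M *m series (fun k : nat => (k`!%:R)^-1 *: X ^+ k) N)).
  by apply: cvg_mulmx; [exact: cvg_cst|exact: cvg_expM].
rewrite (_ : (fun N => _) = fun N =>
   series (fun k : nat => (k`!%:R)^-1 *: X ^+ k) N *m M); last first.
  apply/funext => N; rewrite /series /= mulmx_sumr mulmx_suml.
  apply: eq_bigr => k _; rewrite -scalemxAr -scalemxAl.
  by congr (_ *: _); apply: (commrX k MX).
by apply: cvg_mulmx; [exact: cvg_expM|exact: cvg_cst].
Qed.

Lemma cvg_mx_cstD (K : numFieldType) (m n : nat) (u : nat -> 'M[K]_(m, n))
    (A : 'M[K]_(m, n)) :
  u @ \oo --> (0 : 'M[K]_(m, n)) -> (fun k => A + u k) @ \oo --> A.
Proof.
by move=> u0; rewrite -[X in _ --> X]addr0; apply: cvgD => //; exact: cvg_cst.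
Qed.

(** Both terms tend to exp(2c), since exp(c)^2 = exp(2c). *)
Lemma series_exp_sqr_near (F : realType) (c e : F) : 0 < e ->
  exists M, forall N, (M <= N)%N ->
    series (exp_coeff c) N ^+ 2 - series (exp_coeff (2 * c)) N < e.
Proof.
move=> e0.
have B0 : (fun N => series (exp_coeff c) N * series (exp_coeff c) N
    - series (exp_coeff (2 * c)) N) @ \oo --> expR c * expR c - expR (2 * c).
  apply: cvgB; last exact: is_cvg_series_exp_coeff.
  by apply: cvgM; exact: is_cvg_series_exp_coeff.
move: B0; rewrite -expRD mulrDl mul1r subrr => /cvgrPdist_lt/(_ _ e0)[M _ HM].
exists M => N MN; have := HM N MN; rewrite sub0r normrN expr2.
exact: le_lt_trans (ler_norm _).
Qed.

(* The product of the truncations of exp(x) and exp(-x) is 1 up to terms of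
   degree at least N, whose coefficients are dominated by those of the square of
   the truncation of exp(x). *)
Lemma horner_mx_exp_polyM_le (F : realType) (n : nat) (X : 'M[F[i]]_n.+1)
    (c : F) (N : nat) (i j : 'I_n.+1) :
  0 <= c -> (forall k i j, `|(X ^+ k) i j| <= (c ^+ k)%:C%C) -> (0 < N)%N ->
  `|horner_mx X (map_poly (real_complex F)
      (exp_poly (1 : F) N * exp_poly (-1) N - 1)) i j|
  <= (series (exp_coeff c) N ^+ 2 - series (exp_coeff (2 * c)) N)%:C%C.
Proof.
move=> c0 cX N0; pose m := (N + N)%N.
pose d := exp_poly (1 : F) N * exp_poly (-1) N - 1; rewrite -/d.
have hXn a k : horner_mx X (a *: 'X^k) = a *: X ^+ k.
  by rewrite linearZ /= rmorphXn /= horner_mx_X.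
have szE (a : F) : (size (exp_poly a N) <= N)%N by exact: size_poly.
have szM (a b : F) : (size (exp_poly a N * exp_poly b N)%R <= m)%N.
    apply: (leq_trans (size_polyMleq _ _)).
    by rewrite (leq_trans (leq_pred _)) // leq_add.
have szd : (size d <= m)%N.
    rewrite (leq_trans (size_polyD _ _)) // geq_max szM size_polyN size_poly1.
    by rewrite addn_gt0 N0.
have qE : horner_mx X (map_poly (real_complex F) d) = \sum_(k < m) (d`_k)%:C%C *: X ^+ k.
  have dE : d = \sum_(k < m) d`_k *: 'X^k.
    rewrite -poly_def; apply/polyP => k; rewrite coef_poly.
    by case: ltnP => // mk; rewrite nth_default// (leq_trans szd).
  rewrite [d in LHS]dE !rmorph_sum /=; apply: eq_bigr => k _.
  by rewrite map_polyZ map_polyXn hXn.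
rewrite qE summxE (le_trans (ler_norm_sum _ _ _))//.
apply: (@le_trans _ _ (\sum_(k < m) (`|d`_k| * c ^+ k)%:C%C)).
  apply: ler_sum => k _; rewrite mxE normrM rmorphM /=.
  apply: ler_pM => //.
  by rewrite normc_def /= expr0n /= addr0 sqrtr_sqr.
rewrite -rmorph_sum lecR.
pose e2 := exp_poly (1 : F) N * exp_poly 1 N.
have e2c : e2.[c] = \sum_(k < m) e2`_k * c ^+ k.
  by rewrite (horner_coef_wide _ (szM _ _)).
rewrite expr2 -[in leRHS](mul1r c) -horner_exp_poly -hornerM mul1r e2c.
have -> : series (exp_coeff (2 * c)) N = \sum_(k < m | (k < N)%N) e2`_k * c ^+ k.
  rewrite /series /= big_mkord (big_ord_widen_cond m predT (fun k => exp_coeff (2 * c) k)) ?leq_addr //.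
  apply: eq_bigr => k kN; rewrite coef_exp_polyM // /exp_coeff /= exprMn mulrAC.
  by rewrite -[1 + 1]/(2%:R).
(* Split at degree N: below it the coefficients of [e2] cancel against the truncation of exp(2c) and
   those of [d] vanish, so only the tails are compared. *)
rewrite (bigID (fun k : 'I_m => (k < N)%N)) /= [in leRHS](bigID (fun k : 'I_m => (k < N)%N)) /=.
rewrite addrAC subrr add0r big1 ?add0r => [|k kN].
  apply: ler_sum => k; rewrite -leqNgt => Nk.
  rewrite ler_wpM2r ?exprn_ge0// /d coefB coef1.
  rewrite (negbTE (lt0n_neq0 (leq_trans N0 Nk))) subr0.
  exact: norm_coef_exp_polyM_le.
rewrite /d coefB coef1 coef_exp_polyM // subrr expr0n.
by case: (nat_of_ord k) => [|k'] /=; rewrite ?fact0 ?divr1 ?mul0r subrr normr0 mul0r.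
Qed.

Lemma series_exp_horner_mx (F : realType) (n : nat) (X : 'M[F[i]]_n.+1)
    (s : F) (N : nat) :
  series (fun k : nat => (k`!%:R)^-1 *: (s%:C%C *: X) ^+ k) N
    = horner_mx X (map_poly (real_complex F) (exp_poly s N)).
Proof.
rewrite /series /= big_mkord /exp_poly poly_def rmorph_sum /= rmorph_sum /=.
apply: eq_bigr => k _.
have -> a : horner_mx X (map_poly (real_complex F) (a *: 'X^k)) = a%:C%C *: X ^+ k.
  by rewrite map_polyZ map_polyXn linearZ /= rmorphXn /= horner_mx_X.
by rewrite exprZn scalerA rmorphM fmorphV rmorph_nat rmorphXn mulrC.
Qed.

(** [horner_mx X] is a ring morphism, so the product of the two truncations can be computed among
    real polynomials. *)
Lemma series_expM_mulN (F : realType) (n : nat) (X : 'M[F[i]]_n.+1) (N : nat) :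
  series (fun k : nat => (k`!%:R)^-1 *: X ^+ k) N
    *m series (fun k : nat => (k`!%:R)^-1 *: (- X) ^+ k) N
  = 1%:M + horner_mx X (map_poly (real_complex F)
                          (exp_poly (1 : F) N * exp_poly (-1) N - 1)).
Proof.
have := series_exp_horner_mx X 1 N; rewrite rmorph1 scale1r => ->.
have := series_exp_horner_mx X (-1) N; rewrite rmorphN1 scaleN1r => ->.
rewrite mulmxE -(rmorphM (horner_mx X)) -rmorphM /= rmorphB /= rmorphB /=.
by rewrite (rmorph1 (map_poly _)) (rmorph1 (horner_mx X)) subrKC.
Qed.

Lemma cvg_horner_mx_exp_polyM (F : realType) (n : nat) (X : 'M[F[i]]_n.+1) :
  (fun N => horner_mx X (map_poly (real_complex F)
    (exp_poly (1 : F) N * exp_poly (-1) N - 1))) @ \oo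
    --> (0 : 'M[(F[i] : numFieldType)]_n.+1).
Proof.
have [c c0 cX] := entry_expr_le X.
apply/cvg_mxP => i j; rewrite mxE; apply/cvgrPdist_lt => e e0.
have eE : (complex.Re e)%:C%C = e by rewrite RRe_real ?gtr0_real.
have re0 : 0 < complex.Re e by rewrite -ltcR eE.
have [M HM] := series_exp_sqr_near c re0.
exists (maxn M 1) => // N; rewrite /= geq_max => /andP[MN N0].
rewrite sub0r normrN.
apply: le_lt_trans (horner_mx_exp_polyM_le i j c0 cX N0) _.
by have := HM N MN; rewrite -ltcR eE.
Qed.

Lemma expM_mulN (F : realType) (n : nat) (X : 'M[F[i]]_n) :
  expM X *m expM (- X) = 1%:M.
Proof.
(* The polynomial lemmas are stated in positive size; in size 0 all matrices are equal. *)
case: n X => [|n] X; first by rewrite [LHS]flatmx0 [RHS]flatmx0.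
pose S := fun (Z : 'M[F[i]]_n.+1) => series (fun k : nat => (k`!%:R)^-1 *: Z ^+ k).
apply: (@cvg_mx_unique _ _ _ (fun N => S X N *m S (- X) N)).
  exact: (@cvg_mulmx _ _ (S X) (S (- X)) _ _
    (@cvg_expM _ _ X) (@cvg_expM _ _ (- X))).
have -> : (fun N => S X N *m S (- X) N) = _ := funext (series_expM_mulN X).
exact: (@cvg_mx_cstD _ _ _ _ _ (@cvg_horner_mx_exp_polyM _ _ X)).
Qed.

Lemma expM_unit (F : realType) (n : nat) (X : 'M[F[i]]_n) : expM X \in unitmx.
Proof. exact: (proj1 (mulmx1_unit (expM_mulN X))). Qed.
(** * Cocharacters as Laurent polynomials *)

Lemma poly_eq_neq0 (K : numFieldType) (p q : {poly K}) :
  (forall z, z != 0 -> p.[z] = q.[z]) -> p = q.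
Proof.
move=> pq; apply/eqP; rewrite -subr_eq0; apply/eqP.
(* In characteristic 0 the numbers 1, 2, 3, ... are distinct and nonzero; as many are taken as the
   size of p - q. *)
pose rs : seq K := [seq k.+1%:R | k <- iota 0 (size (p - q))].
apply: (@roots_geq_poly_eq0 _ _ rs); last by rewrite size_map size_iota.
  apply/allP => _ /mapP[k _ ->]; rewrite rootE hornerD hornerN pq ?subrr//.
rewrite map_inj_uniq ?iota_uniq// => k m /eqP.
by rewrite eqr_nat eqSS => /eqP.
Qed.

Definition evalmx (K : comNzRingType) (m n : nat) (P : 'M[{poly K}]_(m, n))
    (z : K) : 'M[K]_(m, n) := map_mx (fun p : {poly K} => p.[z]) P.

Definition coefmx (K : comNzRingType) (m n : nat) (P : 'M[{poly K}]_(m, n))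
    (j : nat) : 'M[K]_(m, n) := map_mx (fun p : {poly K} => p`_j) P.

Definition dermx (K : comNzRingType) (m n : nat) (P : 'M[{poly K}]_(m, n)) :
    'M[{poly K}]_(m, n) := map_mx (fun p : {poly K} => p^`()) P.

Lemma evalmx_sum_coefmx (K : comNzRingType) (m n : nat)
    (P : 'M[{poly K}]_(m, n)) :
  exists N, forall z, evalmx P z = \sum_(j < N) z ^+ j *: coefmx P j.
Proof.
exists (\max_i \max_j size (P i j))%N => z; apply/matrixP => a b.
rewrite summxE mxE (@horner_coef_wide _ (\max_i \max_j size (P i j))%N).
  by apply: eq_bigr => j _; rewrite !mxE mulrC.
by rewrite (leq_trans _ (leq_bigmax a))// (leq_bigmax b).
Qed.

Section CocharPoly.
Context (K : numFieldType) (n : nat) (l : K -> 'M[K]_n) (k : nat)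
  (P : 'M[{poly K}]_n)
  (lM : forall z w, z != 0 -> w != 0 -> l (z * w) = l z *m l w)
  (lP : forall z, z != 0 -> l z = z ^- k *: evalmx P z).

Let evalmxP z : z != 0 -> evalmx P z = z ^+ k *: l z.
Proof. by move=> z0; rewrite lP // scalerA divff ?scale1r// expf_neq0. Qed.

Lemma evalmxM z w : z != 0 -> w != 0 ->
  evalmx P (z * w) = evalmx P z *m evalmx P w.
Proof.
move=> z0 w0; rewrite !evalmxP ?mulf_neq0 // lM // -scalemxAl -scalemxAr.
by rewrite scalerA exprMn.
Qed.

(** Compare the coefficients of w^j in P(zw) = P(z) P(w). This identity is known for nonzero w only,
    hence the passage through [poly_eq_neq0], where [q] is the entry of P(zw) and [r] that of P(z)
    P(w), as polynomials in w. *)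
Lemma eval_coefmx z j : z != 0 ->
  evalmx P z *m coefmx P j = z ^+ j *: coefmx P j.
Proof.
move=> z0; apply/matrixP => a b; rewrite !mxE.
pose q := \poly_(i < size (P a b)) (z ^+ i * (P a b)`_i).
pose r := \sum_c evalmx P z a c *: P c b.
have qr : r = q.
  apply: poly_eq_neq0 => w w0.
  have := congr1 (fun A : 'M[K]_n => A a b) (evalmxM z0 w0).
  rewrite !mxE => e; rewrite /q horner_poly.
  transitivity (P a b).[z * w].
    rewrite e /r horner_sum; apply: eq_bigr => c _.
    by rewrite hornerZ !mxE.
  by rewrite horner_coef; apply: eq_bigr => i _; rewrite exprMn mulrCA mulrA.
transitivity (r`_j).
  by rewrite /r coef_sum; apply: eq_bigr => c _; rewrite coefZ !mxE.
rewrite qr coef_poly; case: ltnP => // sj.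
by rewrite nth_default ?mulr0.
Qed.

Lemma coef_evalmx z j : z != 0 ->
  coefmx P j *m evalmx P z = z ^+ j *: coefmx P j.
Proof.
move=> z0; apply/matrixP => a b; rewrite !mxE.
pose q := \poly_(i < size (P a b)) (z ^+ i * (P a b)`_i).
pose r := \sum_c evalmx P z c b *: P a c.
have qr : r = q.
  apply: poly_eq_neq0 => w w0.
  have := congr1 (fun A : 'M[K]_n => A a b) (evalmxM w0 z0).
  rewrite !mxE => e; rewrite /q horner_poly.
  transitivity (P a b).[w * z].
    rewrite e /r horner_sum; apply: eq_bigr => c _.
    by rewrite hornerZ !mxE mulrC.
  by rewrite horner_coef; apply: eq_bigr => i _; rewrite exprMn mulrA mulrAC [_ * z ^+ i]mulrC.
transitivity (r`_j).
  by rewrite /r coef_sum; apply: eq_bigr => c _; rewrite coefZ !mxE mulrC.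
rewrite qr coef_poly; case: ltnP => // sj.
by rewrite nth_default ?mulr0.
Qed.

Let D := evalmx (dermx P) 1.

(** The derivative at z = 1 of P(z) C_j = z^j C_j, once its entries are read as polynomial
    identities. *)
Lemma der_coefmx j : D *m coefmx P j = j%:R *: coefmx P j.
Proof.
apply/matrixP => a b.
have e : \sum_c coefmx P j c b *: P a c = coefmx P j a b *: 'X^j.
  apply: poly_eq_neq0 => z z0.
  have := congr1 (fun A : 'M[K]_n => A a b) (eval_coefmx j z0); rewrite !mxE => e.
  rewrite hornerZ hornerXn mulrC -e horner_sum; apply: eq_bigr => c _.
  by rewrite hornerZ !mxE mulrC.
have := congr1 (fun p : {poly K} => p^`().[1]) e.
rewrite derivZ derivXn hornerZ hornerMn hornerXn expr1n mxE.
rewrite raddf_sum horner_sum !mxE [j%:R * _]mulrC => <-.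
by apply: eq_bigr => c _ /=; rewrite derivZ hornerZ !mxE mulrC.
Qed.

Lemma coef_dermx j : coefmx P j *m D = j%:R *: coefmx P j.
Proof.
apply/matrixP => a b.
have e : \sum_c coefmx P j a c *: P c b = coefmx P j a b *: 'X^j.
  apply: poly_eq_neq0 => z z0.
  have := congr1 (fun A : 'M[K]_n => A a b) (coef_evalmx j z0); rewrite !mxE => e.
  rewrite hornerZ hornerXn mulrC -e horner_sum; apply: eq_bigr => c _.
  by rewrite hornerZ !mxE.
have := congr1 (fun p : {poly K} => p^`().[1]) e.
rewrite derivZ derivXn hornerZ hornerMn hornerXn expr1n mxE.
rewrite raddf_sum horner_sum !mxE [j%:R * _]mulrC => <-.
by apply: eq_bigr => c _ /=; rewrite derivZ hornerZ !mxE.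
Qed.

(* In the decomposition X = sum_(i, j) C_i X C_j given by the coefficients C_j
   of P, which are the weight projectors of l, each component C_i X C_j has
   weight i - j both under conjugation by l z and under [D, -]. *)
Lemma cochar_weight (X : 'M[K]_n) (f : K -> K) :
  l 1 = 1%:M -> X != 0 ->
  (forall z, z != 0 -> l z *m X = f z *: (X *m l z)) ->
  exists i j, (forall z, z != 0 -> z ^+ i = f z * z ^+ j) /\
              (D *m X = X *m D -> i = j).
Proof.
move=> l1 X0 lX.
have [N PN] := evalmx_sum_coefmx P.
have C1 : \sum_(j < N) coefmx P j = 1%:M.
  rewrite -l1 lP ?oner_neq0 // expr1n invr1 scale1r PN.
  by apply: eq_bigr => j _; rewrite expr1n scale1r.
have [i [j Cij]] : exists i j, coefmx P i *m X *m coefmx P j != 0.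
  apply: contrapT => H; move/eqP: X0; apply.
  rewrite -[X]mul1mx -[X in _ *m X]mulmx1 -C1 mulmxA mulmx_sumr big1 // => j _.
  rewrite !mulmx_suml big1 // => i _.
  by apply/eqP/negP => Cij; apply: H; exists i, j; exact/negP.
exists i, j; split=> [z z0|DX].
  have lX' : evalmx P z *m X = f z *: (X *m evalmx P z).
    by rewrite evalmxP // -scalemxAl lX // -scalemxAr !scalerA mulrC.
  have : (z ^+ i - f z * z ^+ j) *: (coefmx P i *m X *m coefmx P j) = 0.
    rewrite scalerBl; apply/eqP; rewrite subr_eq0; apply/eqP.
    rewrite 2!scalemxAl -coef_evalmx // -[_ *m _ *m X]mulmxA lX'.
    by rewrite -scalemxAr -!scalemxAl -!mulmxA eval_coefmx // -!scalemxAr scalerA.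
  by move/eqP; rewrite scaler_eq0 (negbTE Cij) orbF subr_eq0 => /eqP.
have : (i%:R - j%:R : K) *: (coefmx P i *m X *m coefmx P j) = 0.
  rewrite scalerBl; apply/eqP; rewrite subr_eq0; apply/eqP.
  rewrite 2!scalemxAl -coef_dermx -[_ *m _ *m X]mulmxA DX.
  by rewrite -!mulmxA der_coefmx -!scalemxAr.
by move/eqP; rewrite scaler_eq0 (negbTE Cij) orbF subr_eq0 eqr_nat => /eqP.
Qed.

End CocharPoly.
(** * Polynomial functions of a matrix *)

Lemma mpoly_ring_ind (n : nat) (R : comNzRingType) (Q : mpoly.mpoly n R -> Prop) :
  (forall c, Q (mpoly.mpolyC n c)) ->
  (forall i, Q (mpoly.mpolyX R (mpoly.mnm1 i))) ->
  (forall p q, Q p -> Q q -> Q (p + q)) ->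
  (forall p q, Q p -> Q q -> Q (p * q)) -> forall p, Q p.
Proof.
move=> QC QX QD QM; apply: mpoly.mpolyind => [|c m p _ _ Qp].
  by rewrite -(mpoly.mpolyC0 n R).
apply: QD => //; rewrite -mpoly.mul_mpolyC; apply: (QM) => //.
rewrite mpoly.mpolyXE_id; elim/big_rec : _ => [|i x _ Qx].
  by rewrite -(mpoly.mpolyC1 n R).
apply: (QM) => //; elim: (mpoly.fun_of_multinom m i) => [|k IH].
  by rewrite expr0 -(mpoly.mpolyC1 n R).
by rewrite exprS; apply: QM.
Qed.

Lemma mderivXU (n : nat) (R : nzRingType) (i j : 'I_n) :
  mpoly.mderiv i (mpoly.mpolyX R (mpoly.mnm1 j)) = (j == i)%:R.
Proof.
rewrite mpoly.mderivX mpoly.mnm1E; case: eqVneq => [->|_]; last by rewrite scale0r.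
rewrite (_ : mpoly.mnm_sub _ _ = mpoly.mnm0) ?mpoly.mpolyX0 ?scale1r //.
by apply/mpoly.mnmP => k; rewrite mpoly.mnmBE mpoly.mnm0E subnn.
Qed.

Lemma horner_mmap_polyC (n : nat) (R : comNzRingType) (u : 'I_n -> {poly R})
    (f : mpoly.mpoly n R) (t : R) :
  (mpoly.mmap polyC u f).[t] = mpoly.meval (fun i => (u i).[t]) f.
Proof.
elim/mpoly_ring_ind : f => [c|i|p q Hp Hq|p q Hp Hq].
- by rewrite mpoly.mmapC mpoly.mevalC hornerC.
- by rewrite mpoly.mmapX mpoly.mmap1U mpoly.mevalXU.
- by rewrite !rmorphD /= hornerD Hp Hq.
- by rewrite !rmorphM /= hornerM Hp Hq.
Qed.

(** The chain rule along the polynomial curve u. *)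
Lemma deriv_mmap_polyC (n : nat) (R : comNzRingType) (u : 'I_n -> {poly R})
    (f : mpoly.mpoly n R) :
  (mpoly.mmap polyC u f)^`() =
  \sum_i mpoly.mmap polyC u (mpoly.mderiv i f) * (u i)^`().
Proof.
elim/mpoly_ring_ind : f => [c|j|p q Hp Hq|p q Hp Hq].
- rewrite mpoly.mmapC derivC big1 // => i _.
  by rewrite mpoly.mderivC rmorph0 mul0r.
- rewrite mpoly.mmapX mpoly.mmap1U (bigD1 j) //= big1 ?addr0 => [|i ij].
    by rewrite mderivXU eqxx rmorph1 mul1r.
  by rewrite mderivXU eq_sym (negbTE ij) rmorph0 mul0r.
- rewrite rmorphD /= derivD Hp Hq -big_split /=; apply: eq_bigr => i _.
  by rewrite mpoly.mderivD rmorphD mulrDl.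
- rewrite rmorphM /= derivM Hp Hq mulr_suml mulr_sumr -big_split /=.
  apply: eq_bigr => i _; rewrite mpoly.mderivM rmorphD !rmorphM /=; ring.
Qed.

Lemma meval_map_mpoly (n : nat) (R S : comNzRingType) (g : {rmorphism R -> S})
    (v : 'I_n -> R) (f : mpoly.mpoly n R) :
  mpoly.meval (fun i => g (v i)) (mpoly.map_mpoly g f) = g (mpoly.meval v f).
Proof.
elim/mpoly_ring_ind : f => [c|i|p q Hp Hq|p q Hp Hq].
- by rewrite mpoly.map_mpolyC !mpoly.mevalC.
- by rewrite mpoly.map_mpolyX !mpoly.mevalXU.
- by rewrite !rmorphD /= Hp Hq.
- by rewrite !rmorphM /= Hp Hq.
Qed.

Lemma map_mpoly_fixed (n : nat) (R S : comNzRingType) (g : {rmorphism S -> S})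
    (h : {rmorphism R -> S}) (f : mpoly.mpoly n R) :
  (forall x, g (h x) = h x) ->
  mpoly.map_mpoly g (mpoly.map_mpoly h f) = mpoly.map_mpoly h f.
Proof.
move=> gh; apply/mpoly.mpolyP => m.
by rewrite !mpoly.mcoeff_map_mpoly; exact: gh.
Qed.

Lemma mderiv_map_mpoly (n : nat) (R S : comNzRingType) (g : {rmorphism R -> S})
    (i : 'I_n) (f : mpoly.mpoly n R) :
  mpoly.mderiv i (mpoly.map_mpoly g f) = mpoly.map_mpoly g (mpoly.mderiv i f).
Proof.
elim/mpoly_ring_ind : f => [c|j|p q Hp Hq|p q Hp Hq].
- by rewrite mpoly.map_mpolyC !mpoly.mderivC rmorph0.
- by rewrite mpoly.map_mpolyX !mderivXU rmorph_nat.
- by rewrite rmorphD /= !mpoly.mderivD rmorphD /= Hp Hq.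
- by rewrite rmorphM /= !mpoly.mderivM rmorphD !rmorphM /= Hp Hq.
Qed.

(** A tangent vector can be applied only to actual polynomials in the entries. The closure
    properties below produce them without writing them out. *)
Definition polyfun (F : realType) (n : nat) (phi : 'M[F[i]]_n -> F[i]) : Prop :=
  exists h, forall A, phi A = ev h A.

Section Polyfun.
Context (F : realType) (n : nat).
Implicit Types phi psi : 'M[F[i]]_n -> F[i].

Lemma polyfun_cst (c : F[i]) : polyfun (fun _ : 'M[F[i]]_n => c).
Proof. by exists (mpoly.mpolyC _ c) => A; rewrite /ev mpoly.mevalC. Qed.

Lemma polyfun_entry i j : polyfun (fun A : 'M[F[i]]_n => A i j).
Proof.
exists (mpoly.mpolyX _ (mpoly.mnm1 (mxvec_index i j))) => A.
by rewrite /ev mpoly.mevalXU mxvecE.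
Qed.

Lemma polyfunD phi psi : polyfun phi -> polyfun psi ->
  polyfun (fun A => phi A + psi A).
Proof.
by move=> [p Hp] [q Hq]; exists (p + q) => A; rewrite Hp Hq /ev rmorphD.
Qed.

Lemma polyfunM phi psi : polyfun phi -> polyfun psi ->
  polyfun (fun A => phi A * psi A).
Proof.
by move=> [p Hp] [q Hq]; exists (p * q) => A; rewrite Hp Hq /ev rmorphM.
Qed.

Lemma polyfun_sum (I : Type) (r : seq I) (phi : I -> 'M[F[i]]_n -> F[i]) :
  (forall i, polyfun (phi i)) -> polyfun (fun A => \sum_(i <- r) phi i A).
Proof.
move=> H; elim: r => [|x r IH].
  by have [h hE] := polyfun_cst 0; exists h => A; rewrite big_nil -hE.
have [h hE] := polyfunD (H x) IH.
by exists h => A; rewrite big_cons -hE.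
Qed.

Lemma polyfun_prod (I : Type) (r : seq I) (phi : I -> 'M[F[i]]_n -> F[i]) :
  (forall i, polyfun (phi i)) -> polyfun (fun A => \prod_(i <- r) phi i A).
Proof.
move=> H; elim: r => [|x r IH].
  by have [h hE] := polyfun_cst 1; exists h => A; rewrite big_nil -hE.
have [h hE] := polyfunM (H x) IH.
by exists h => A; rewrite big_cons -hE.
Qed.

Lemma polyfun_comp (f : mpoly.mpoly (n * n) F[i])
    (Q : 'M[F[i]]_n -> 'M[F[i]]_n) :
  (forall i j, polyfun (fun A => Q A i j)) -> polyfun (fun A => ev f (Q A)).
Proof.
move=> HQ; elim/mpoly_ring_ind : f => [c|k|p q Hp Hq|p q Hp Hq].
- have [h hE] := polyfun_cst c.
  by exists h => A; rewrite -hE /ev mpoly.mevalC.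
- case/mxvec_indexP: k => i j; have [h hE] := HQ i j.
  by exists h => A; rewrite -hE /ev mpoly.mevalXU mxvecE.
- have [h hE] := polyfunD Hp Hq.
  by exists h => A; rewrite -hE /ev rmorphD.
- have [h hE] := polyfunM Hp Hq.
  by exists h => A; rewrite -hE /ev rmorphM.
Qed.

Lemma polyfun_mulmx (Q Q' : 'M[F[i]]_n -> 'M[F[i]]_n) :
  (forall i j, polyfun (fun A => Q A i j)) ->
  (forall i j, polyfun (fun A => Q' A i j)) ->
  forall i j, polyfun (fun A => (Q A *m Q' A) i j).
Proof.
move=> HQ HQ' i j.
have [h hE] := polyfun_sum (index_enum _) (fun k => polyfunM (HQ i k) (HQ' k j)).
by exists h => A; rewrite -hE mxE.
Qed.

Lemma polyfun_det m (Q : 'M[F[i]]_n -> 'M[F[i]]_m) :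
  (forall i j, polyfun (fun A => Q A i j)) -> polyfun (fun A => \det (Q A)).
Proof.
move=> HQ.
have [h hE] := polyfun_sum (index_enum _) (fun s : 'S_m =>
  polyfunM (polyfun_cst ((-1) ^+ s))
    (polyfun_prod (index_enum _) (fun i => HQ i (s i)))).
by exists h => A; rewrite -hE.
Qed.

(** The adjugate will stand in for the inverse, which is not polynomial. *)
Lemma polyfun_adj i j : polyfun (fun A : 'M[F[i]]_n => (\adj A) i j).
Proof.
have HD : forall k l, polyfun (fun A : 'M[F[i]]_n => row' j (col' i A) k l).
  move=> k l; have [h hE] := polyfun_entry (lift j k) (lift i l).
  by exists h => A; rewrite -hE !mxE.
have [h hE] := polyfunM (polyfun_cst ((-1) ^+ (j + i))) (polyfun_det HD).
by exists h => A; rewrite -hE mxE.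
Qed.

End Polyfun.
(** * The Lie algebra *)

Section LieAlgebra.
Context (F : realType) (n : nat).
Implicit Types (G : set 'M[F[i]]_n) (X Y Z g : 'M[F[i]]_n)
  (f : mpoly.mpoly (n * n) F[i]) (phi : 'M[F[i]]_n -> F[i]).

(** The differential of f at the identity: [Lie G] is the common kernel of these forms for f
    vanishing on G. *)
Definition der1 f X : F[i] :=
  \sum_(k < n * n) mxvec X 0 k * ev (mpoly.mderiv k f) 1%:M.

Definition curve f (M : 'M[{poly F[i]}]_n) : {poly F[i]} :=
  mpoly.mmap polyC (fun k => mxvec M 0 k) f.

Definition line X : 'M[{poly F[i]}]_n := 1%:M + 'X *: map_mx polyC X.

Lemma evalmx_line X t : evalmx (line X) t = 1%:M + t *: X.
Proof.
apply/matrixP => i j; rewrite !mxE hornerD hornerM hornerX hornerC.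
by rewrite hornerMn hornerC.
Qed.

Lemma dermx_line X t : evalmx (dermx (line X)) t = X.
Proof.
apply/matrixP => i j; rewrite !mxE derivD derivM derivX derivC mul1r mulr0 addr0.
by rewrite derivMn derivC mul0rn add0r hornerC.
Qed.

Lemma evalmx_mxvec (M : 'M[{poly F[i]}]_n) k t :
  (mxvec M 0 k).[t] = mxvec (evalmx M t) 0 k.
Proof. by case/mxvec_indexP: k => i j; rewrite !mxvecE mxE. Qed.

Lemma horner_curve f (M : 'M[{poly F[i]}]_n) t :
  (curve f M).[t] = ev f (evalmx M t).
Proof.
rewrite /curve horner_mmap_polyC /ev; apply: mpoly.meval_eq => k.
exact: evalmx_mxvec.
Qed.

Lemma deriv_curve f (M : 'M[{poly F[i]}]_n) : evalmx M 0 = 1%:M ->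
  (curve f M)^`().[0] = der1 f (evalmx (dermx M) 0).
Proof.
move=> M0; rewrite /curve deriv_mmap_polyC horner_sum /der1.
apply: eq_bigr => k _; rewrite hornerM mulrC; congr (_ * _); last first.
  by rewrite -/(curve _ _) horner_curve M0.
by case/mxvec_indexP: k => i j; rewrite !mxvecE !mxE.
Qed.

Lemma der1_is_linear f : linear (der1 f).
Proof.
move=> a X Y; rewrite /der1 scaler_sumr -big_split /=; apply: eq_bigr => k _.
by rewrite linearP /= !mxE mulrDl -mulrA.
Qed.

Lemma der1D f X Y : der1 f (X + Y) = der1 f X + der1 f Y.
Proof. by rewrite -[X in der1 f (X + _)]scale1r der1_is_linear scale1r. Qed.

Lemma der1Z f a X : der1 f (a *: X) = a * der1 f X.
Proof.
have := der1_is_linear f a X 0; rewrite addr0 => ->.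
rewrite /der1 [X in _ + X]big1 ?addr0 // => k _.
by rewrite linear0 mxE mul0r.
Qed.

Lemma Lie_curve G X phi (p : {poly F[i]}) :
  Lie G X -> polyfun phi -> (forall A, G A -> phi A = 0) ->
  (forall t, p.[t] = phi (1%:M + t *: X)) -> p^`().[0] = 0.
Proof.
move=> GX [h hE] phiG pE.
have -> : p = curve h (line X).
  by apply: poly_eq_neq0 => t _; rewrite horner_curve evalmx_line -hE.
rewrite deriv_curve ?evalmx_line ?scale0r ?addr0 // dermx_line.
by apply: GX => A GA; rewrite -hE phiG.
Qed.

Lemma polyfun_mx_cst (C : 'M[F[i]]_n) i j : polyfun (fun _ : 'M[F[i]]_n => C i j).
Proof. exact: polyfun_cst. Qed.

(** If f vanishes on G, so does f composed with [Int g], and its derivative along X is the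
    differential of f at [Int g X]. *)
Lemma Lie_Int G g X : is_subgroup G -> G g -> Lie G X -> Lie G (Int g X).
Proof.
move=> [GU _ GM GV] Gg GX f fG.
have gU : g \in unitmx by exact: GU.
rewrite -/(der1 f _) -[Int g X](dermx_line _ 0) -deriv_curve; last first.
  by rewrite evalmx_line scale0r addr0.
apply: (@Lie_curve G X (fun A => ev f (Int g A))) => //.
- apply: polyfun_comp => i j; rewrite /Int.
  by apply: polyfun_mulmx => {i j}; [apply: polyfun_mulmx => //|];
     [exact: polyfun_mx_cst|exact: polyfun_entry|exact: polyfun_mx_cst].
- by move=> A GA; apply: fG; apply: (GM); [exact: GM|exact: GV].
- move=> t; rewrite horner_curve evalmx_line /Int mulmxDr mulmx1 mulmxDl mulmxV //.
  by rewrite -scalemxAr -scalemxAl.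
Qed.

Lemma dermxM (M N : 'M[{poly F[i]}]_n) :
  dermx (M *m N) = dermx M *m N + M *m dermx N.
Proof.
apply/matrixP => i j; rewrite !mxE raddf_sum -big_split /=.
by apply: eq_bigr => k _; rewrite derivM !mxE.
Qed.

Lemma evalmx_mul (M N : 'M[{poly F[i]}]_n) t :
  evalmx (M *m N) t = evalmx M t *m evalmx N t.
Proof.
apply/matrixP => i j; rewrite !mxE horner_sum.
by apply: eq_bigr => k _; rewrite hornerM !mxE.
Qed.

Lemma evalmx_cst X t : evalmx (map_mx polyC X) t = X.
Proof. by apply/matrixP => i j; rewrite !mxE hornerC. Qed.

Lemma dermx_cst X : dermx (map_mx polyC X) = 0.
Proof. by apply/matrixP => i j; rewrite !mxE derivC. Qed.

Lemma evalmxD (M N : 'M[{poly F[i]}]_n) t :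
  evalmx (M + N) t = evalmx M t + evalmx N t.
Proof. by apply/matrixP => i j; rewrite !mxE hornerD. Qed.

Lemma evalmx_adj (M : 'M[{poly F[i]}]_n) t : evalmx (\adj M) t = \adj (evalmx M t).
Proof. exact: (map_mx_adj (horner_eval t) M). Qed.

(* Differentiating M (adj M) = det M at 1 along 1 + tX. *)
Lemma dermx_adj_line X : exists a,
  evalmx (dermx (\adj (line X))) 0 = a%:M - X.
Proof.
exists (\det (line X))^`().[0].
have := congr1 (fun M => evalmx (dermx M) 0) (mul_mx_adj (line X)).
rewrite dermxM evalmxD !evalmx_mul dermx_line evalmx_line scale0r addr0 mul1mx.
rewrite evalmx_adj evalmx_line scale0r addr0.
have -> : \adj (1%:M : 'M[F[i]]_n) = 1%:M.
  by rewrite -[LHS]mul1mx mul_mx_adj det1.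
rewrite mulmx1 => /(canRL (addKr X)) ->; rewrite addrC; congr (_ - _).
apply/matrixP => i j; rewrite !mxE; case: eqP => _; first by rewrite !mulr1n.
by rewrite !mulr0n derivC hornerC.
Qed.

(* The function A |-> d f_1(A Y adj(A)) vanishes on G by Ad-invariance; its
   derivative at 1 along X is d f_1([X, Y]) plus a multiple of d f_1(Y). *)
Lemma Lie_bracket G X Y :
  is_subgroup G -> Lie G X -> Lie G Y -> Lie G (bracket X Y).
Proof.
move=> Gsub GX GY f fG; rewrite -/(der1 f _).
pose phi := fun A : 'M[F[i]]_n => der1 f (A *m Y *m \adj A).
have phi_poly : polyfun phi.
  apply: polyfun_sum => k; apply: polyfunM; last exact: polyfun_cst.
  case/mxvec_indexP: k => i j.
  have H : forall i j, polyfun (fun A : 'M[F[i]]_n => (A *m Y *m \adj A) i j).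
    apply: polyfun_mulmx; last exact: polyfun_adj.
    by apply: polyfun_mulmx; [exact: polyfun_entry|exact: polyfun_mx_cst].
  by have [h hE] := H i j; exists h => A; rewrite -hE mxvecE.
have phi0 A : G A -> phi A = 0.
  move=> GA; have AU : A \in unitmx by case: Gsub => GU _ _ _; exact: GU.
  rewrite /phi.
  (* On G the adjugate is the inverse times the determinant, so Ad-invariance applies up to a
     scalar. *)
  have -> : A *m Y *m \adj A = \det A *: Int A Y.
    rewrite /Int scalemxAr; congr (_ *m _); rewrite /invmx AU scalerA.
    by rewrite divff ?scale1r // -unitfE -unitmxE.
  by rewrite der1Z [der1 f _](Lie_Int Gsub GA GY) ?mulr0.
pose M := line X *m map_mx polyC Y *m \adj (line X).
pose p := \sum_(k < n * n) mxvec M 0 k * (ev (mpoly.mderiv k f) 1%:M)%:P.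
have pE t : p.[t] = phi (1%:M + t *: X).
  rewrite /p horner_sum; apply: eq_bigr => k _.
  rewrite hornerM hornerC evalmx_mxvec; congr (mxvec _ 0 k * _).
  by rewrite !evalmx_mul evalmx_cst evalmx_adj evalmx_line.
have := Lie_curve GX phi_poly phi0 pE.
have -> : p^`().[0] = der1 f (evalmx (dermx M) 0).
  rewrite /p raddf_sum horner_sum; apply: eq_bigr => k _ /=.
  rewrite derivM derivC mulr0 addr0 hornerM hornerC; congr (_ * _).
  by case/mxvec_indexP: k => i j; rewrite !mxvecE !mxE.
have [a aE] := dermx_adj_line X.
rewrite /M !dermxM dermx_cst mulmx0 addr0 evalmxD !evalmx_mul dermx_line aE.
rewrite evalmx_cst evalmx_adj !evalmx_line scale0r addr0 mul1mx.
have -> : \adj (1%:M : 'M[F[i]]_n) = 1%:M.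
  by rewrite -[LHS]mul1mx mul_mx_adj det1.
rewrite mulmx1 mulmxBr mul_mx_scalar addrCA der1D der1Z [der1 f Y]GY // mulr0.
by rewrite add0r.
Qed.

(** * Complex conjugation of real groups and their Lie algebras *)

Lemma conjM_mul X Y : conjM (X *m Y) = conjM X *m conjM Y.
Proof. exact: map_mxM. Qed.

Lemma conjMK X : conjM (conjM X) = X.
Proof. by apply/matrixP => i j; rewrite !mxE conjcK. Qed.

Lemma conjM_invmx X : conjM (invmx X) = invmx (conjM X).
Proof. exact: map_invmx. Qed.

Definition conj_mpoly f : mpoly.mpoly (n * n) F[i] :=
  mpoly.map_mpoly (@conjc F) f.

Lemma ev_conj f A : ev (conj_mpoly f) (conjM A) = conjc (ev f A).
Proof.
rewrite /ev -[RHS]meval_map_mpoly; apply: mpoly.meval_eq => k.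
by case/mxvec_indexP: k => i j; rewrite !mxvecE mxE.
Qed.

Lemma conj_real_mpoly (f : mpoly.mpoly (n * n) F) :
  conj_mpoly (mpoly.map_mpoly (real_complex F) f)
    = mpoly.map_mpoly (real_complex F) f.
Proof.
exact: (@map_mpoly_fixed _ _ _ (@conjc F : {rmorphism F[i] -> F[i]})
  (real_complex F : {rmorphism F -> F[i]}) f (@conjc_real F)).
Qed.

Lemma mderiv_conj k f : mpoly.mderiv k (conj_mpoly f) = conj_mpoly (mpoly.mderiv k f).
Proof. exact: mderiv_map_mpoly. Qed.

Lemma ev_real_conj (f : mpoly.mpoly (n * n) F) A :
  ev (mpoly.map_mpoly (real_complex F) f) (conjM A)
    = conjc (ev (mpoly.map_mpoly (real_complex F) f) A).
Proof.
exact: etrans (congr1 (fun h => ev h (conjM A)) (esym (conj_real_mpoly f)))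
  (ev_conj _ _).
Qed.

Lemma zclosedR_conj G A :
  zclosed (real_complex F : {rmorphism F -> F[i]}) G -> G A -> G (conjM A).
Proof.
move=> [S ->] /= [AU AS]; split; first by rewrite map_unitmx.
by move=> f Sf; rewrite ev_real_conj AS // conjc0.
Qed.

(** G is stable under conjugation, so the conjugate of a polynomial vanishing on G vanishes on G;
    its differential at X is the conjugate of that of f at [conjM X]. *)
Lemma Lie_conj G X :
  zclosed (real_complex F : {rmorphism F -> F[i]}) G ->
  Lie G X -> Lie G (conjM X).
Proof.
move=> GR GX f fG.
have H := GX (conj_mpoly f) _; apply: (can_inj (@conjcK F)).
rewrite rmorph0 -[RHS]H => [|A GA]; last first.
  by rewrite -[A]conjMK ev_conj fG ?conjc0 //; exact: zclosedR_conj.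
rewrite rmorph_sum; apply: eq_bigr => k _; rewrite rmorphM /=; congr (_ * _).
  by case/mxvec_indexP: k => i j; rewrite !mxvecE mxE conjcK.
have c1 : conjM (1%:M : 'M[F[i]]_n) = 1%:M.
  by apply/matrixP => i j; rewrite !mxE rmorph_nat.
by rewrite mderiv_conj -[in RHS]c1 ev_conj.
Qed.

End LieAlgebra.
(** * Weight vectors of a torus *)

Section Roots.
Context (F : realType) (n : nat).
Implicit Types (G T : set 'M[F[i]]_n) (a b c : 'M[F[i]]_n -> F[i])
  (l : F[i] -> 'M[F[i]]_n) (X Y Z H g m t u : 'M[F[i]]_n).

Lemma Int_comm g X : g \in unitmx -> g *m X = X *m g -> Int g X = X.
Proof. by move=> gU gX; rewrite /Int gX mulmxK. Qed.

Lemma invmx_mul g m : g \in unitmx -> m \in unitmx ->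
  invmx (g *m m) = invmx m *m invmx g.
Proof.
move=> gU mU; have gmU : g *m m \in unitmx by rewrite unitmx_mul gU.
rewrite -[RHS](mulKmx gmU) -mulmxA [m *m (_ *m _)]mulmxA mulmxV // mul1mx.
by rewrite mulmxV // mulmx1.
Qed.

Lemma Int_mul g m X : g \in unitmx -> m \in unitmx ->
  Int (g *m m) X = Int g (Int m X).
Proof. by move=> gU mU; rewrite /Int invmx_mul // !mulmxA. Qed.

Lemma IntK g X : g \in unitmx -> Int (invmx g) (Int g X) = X.
Proof. by move=> gU; rewrite /Int invmxK !mulmxA mulVmx // mul1mx mulmxKV. Qed.

Lemma Int_bracket g X Y : g \in unitmx ->
  Int g (bracket X Y) = bracket (Int g X) (Int g Y).
Proof.
move=> gU; rewrite /bracket /Int mulmxBr mulmxBl !mulmxA.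
by rewrite !mulmxKV.
Qed.

Lemma bracket0_comm X Y : bracket X Y = 0 -> X *m Y = Y *m X.
Proof. by move/eqP; rewrite subr_eq0 => /eqP. Qed.

Lemma Int_scale g (x : F[i]) X : Int g (x *: X) = x *: Int g X.
Proof. by rewrite /Int -scalemxAr -scalemxAl. Qed.

Lemma is_subgroup_unit G g : is_subgroup G -> G g -> g \in unitmx.
Proof. by move=> [GU _ _ _] Gg; exact: GU. Qed.

Definition eigenvector_of T c X : Prop := forall t, T t -> Int t X = c t *: X.

Lemma scaler_inj_neq0 (X : 'M[F[i]]_n) (x y : F[i]) :
  X != 0 -> x *: X = y *: X -> x = y.
Proof.
move=> X0 /eqP; rewrite -subr_eq0 -scalerBl scaler_eq0 (negbTE X0) orbF.
by rewrite subr_eq0 => /eqP.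
Qed.

(** A nonzero eigenvector forces multiplicativity: compare the action of [t *m u] with the
    successive actions of u and t. *)
Lemma eigenvector_mul T c X t u : is_subgroup T -> X != 0 ->
  eigenvector_of T c X -> T t -> T u -> c (t *m u) = c t * c u.
Proof.
move=> Tsub X0 TX Tt Tu; apply: (scaler_inj_neq0 X0).
have [_ _ TM _] := Tsub.
rewrite -TX; last exact: TM.
rewrite Int_mul ?(is_subgroup_unit Tsub) // TX // Int_scale TX // scalerA.
by rewrite mulrC.
Qed.

Lemma eigenvector_one T c X : is_subgroup T -> X != 0 ->
  eigenvector_of T c X -> c 1%:M = 1.
Proof.
move=> Tsub X0 TX; apply: (scaler_inj_neq0 X0).
have [_ T1 _ _] := Tsub.
by rewrite -TX // /Int invmx1 mul1mx mulmx1 scale1r.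
Qed.

Lemma eigenvector_inv T c X t : is_subgroup T -> X != 0 ->
  eigenvector_of T c X -> T t -> c (invmx t) = (c t)^-1.
Proof.
move=> Tsub X0 TX Tt.
have [_ _ _ TV] := Tsub; have tU := is_subgroup_unit Tsub Tt.
have e : c t * c (invmx t) = 1.
  rewrite -(eigenvector_mul Tsub X0 TX) ?mulmxV //; last exact: TV.
  exact: eigenvector_one TX.
have ct0 : c t != 0.
  by apply/eqP => ct0; move/eqP: e; rewrite ct0 mul0r eq_sym oner_eq0.
by apply: (mulfI ct0); rewrite e divff.
Qed.

Lemma cochar_one T l : is_subgroup T -> cochar T l -> l 1 = 1%:M.
Proof.
move=> Tsub [_ lT lM _].
have l1U : l 1 \in unitmx by apply: (is_subgroup_unit Tsub); apply: lT; exact: oner_neq0.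
have := lM 1 1 (oner_neq0 _) (oner_neq0 _); rewrite mulr1.
by move/(congr1 (mulmx (invmx (l 1)))); rewrite mulVmx // mulKmx.
Qed.

(** This is c(l z) = z^<c, l>, with the integer <c, l> = i - j kept as two natural numbers. *)
Lemma eigenvector_cochar T c l X : is_subgroup T -> cochar T l -> X != 0 ->
  eigenvector_of T c X ->
  exists i j : nat, forall z, z != 0 -> z ^+ i = c (l z) * z ^+ j.
Proof.
move=> Tsub lc X0 TX; have l1 := cochar_one Tsub lc.
have [_ lT lM [k [P lP]]] := lc.
have [|i [j [ij _]]] := cochar_weight lM lP (f := fun z => c (l z)) l1 X0.
  move=> z z0; have Tl := lT _ z0; rewrite scalemxAl -TX //.
  by rewrite /Int mulmxKV // (is_subgroup_unit Tsub).
by exists i, j.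
Qed.

(** From the Lie algebra back to the group: dl(1) acts on X by the integer <c, l>, which in
    characteristic 0 is determined by its image in the field. *)
Lemma eigenvector_dcochar T c l X H : is_subgroup T -> cochar T l -> X != 0 ->
  eigenvector_of T c X -> is_dcochar l H -> H *m X = X *m H ->
  forall z, z != 0 -> c (l z) = 1.
Proof.
move=> Tsub lc X0 TX [k [P [lP HE]]] HX; have l1 := cochar_one Tsub lc.
have [_ lT lM _] := lc.
have [|i [j [ij DX]]] := cochar_weight lM lP (f := fun z => c (l z)) l1 X0.
  move=> z z0; have Tl := lT _ z0; rewrite scalemxAl -TX //.
  by rewrite /Int mulmxKV // (is_subgroup_unit Tsub).
have P1 : map_mx (fun p : {poly F[i]} => p.[1]) P = 1%:M.
  have := lP 1 (oner_neq0 _); rewrite l1 expr1n invr1 scale1r.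
  by move=> ->.
have eij : i = j.
  (* The factor z^-k of l shifts the derivative of P by the scalar k, which commutes with X. *)
  apply: DX; have -> : evalmx (dermx P) 1 = H + k%:R%:M.
    rewrite HE P1 scalemx1 subrK.
    by apply/matrixP => x y; rewrite !mxE.
  by rewrite mulmxDl mulmxDr HX mul_mx_scalar mul_scalar_mx.
move=> z z0; have := ij z z0; rewrite eij => e.
by apply: (mulIf (expf_neq0 j z0)); rewrite mul1r -e.
Qed.

End Roots.

(** * Split tori and the reality of their characters *)

Section SplitTorus.
Context (F : realType) (n : nat).
Implicit Types (T : set 'M[F[i]]_n) (c : 'M[F[i]]_n -> F[i]).

(** The ring is arbitrary so that the generic point [coord_mx i 'X] can be substituted into a
    regular function. *)
Definition coord_mx (r : nat) (i : 'I_r) (R : comNzRingType) (z : R) : 'M[R]_r :=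
  diag_mx (\row_j if j == i then z else 1).

Lemma det_coord_mx r (i : 'I_r) (R : comNzRingType) (z : R) :
  \det (coord_mx i z) = z.
Proof.
rewrite det_diag (bigD1 i) //= mxE eqxx big1 ?mulr1 // => j /negbTE ji.
by rewrite mxE ji.
Qed.

Lemma coord_mx_diag_group r (i : 'I_r) (z : F[i]) : z != 0 ->
  diag_group F r (coord_mx i z).
Proof.
move=> z0; split; last exact: diag_mx_is_diag.
by rewrite unitmxE det_coord_mx unitfE.
Qed.

Lemma coord_mxM r (i : 'I_r) (R : comNzRingType) (z w : R) :
  coord_mx i (z * w) = coord_mx i z *m coord_mx i w.
Proof.
rewrite mulmx_diag; congr diag_mx; apply/rowP => j; rewrite !mxE.
by case: eqP => // _; rewrite mulr1.
Qed.

Lemma diag_groupM r (A B : 'M[F[i]]_r) :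
  diag_group F r A -> diag_group F r B -> diag_group F r (A *m B).
Proof.
move=> [AU AD] [BU BD]; split; first by rewrite unitmx_mul AU.
case/diag_mxP: AD => a ->; case/diag_mxP: BD => b ->.
by rewrite mulmx_diag; exact: diag_mx_is_diag.
Qed.

Lemma diag_group1 r : diag_group F r 1%:M.
Proof. by split; [exact: unitmx1|exact: scalar_mx_is_diag]. Qed.

Lemma diag_mx_prod r (d : 'rV[F[i]]_r) :
  diag_mx d = \big[@mulmx _ r r r/1%:M]_(i < r) coord_mx i (d 0 i).
Proof.
have H (s : seq 'I_r) : \big[@mulmx _ r r r/1%:M]_(i <- s) coord_mx i (d 0 i) =
    diag_mx (\row_j \prod_(i <- s) (if j == i then d 0 i else 1)).
  elim: s => [|i s IH].
    rewrite big_nil -diag_const_mx; congr diag_mx; apply/rowP => j.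
    by rewrite !mxE big_nil.
  rewrite big_cons IH mulmx_diag; congr diag_mx; apply/rowP => j.
  by rewrite !mxE big_cons.
rewrite H; congr diag_mx; apply/rowP => j; rewrite mxE.
rewrite (bigD1 j) //= eqxx big1 ?mulr1 // => i ij.
by rewrite eq_sym (negbTE ij).
Qed.

Definition coord_cochar (r : nat) (phi : 'M[F[i]]_r -> 'M[F[i]]_n) (i : 'I_r)
    (z : F[i]) : 'M[F[i]]_n := if z == 0 then 0 else phi (coord_mx i z).

Lemma coord_cocharP (K : comNzRingType) (iota : {rmorphism K -> F[i]}) T r
    (phi : 'M[F[i]]_r -> 'M[F[i]]_n) (i : 'I_r) :
  alg_morph iota (diag_group F r) T phi -> cochar T (coord_cochar phi i).
Proof.
move=> [phiT phiM phiR]; rewrite /coord_cochar; split.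
- by rewrite eqxx.
- by move=> z z0; rewrite (negbTE z0); apply: phiT; exact: coord_mx_diag_group.
- move=> z w z0 w0; rewrite mulf_eq0 (negbTE z0) (negbTE w0) /= coord_mxM phiM //;
  exact: coord_mx_diag_group.
(* The determinant of [coord_mx i z] is z, so p / det^k becomes a Laurent polynomial in z. *)
have /choice[kp kpP] : forall ab : 'I_n * 'I_n, exists kp : nat * {poly F[i]},
    forall z, z != 0 -> phi (coord_mx i z) ab.1 ab.2 = kp.2.[z] / z ^+ kp.1.
  move=> [a b] /=; have [k [p pE]] := phiR a b.
  exists (k, curve (mpoly.map_mpoly iota p) (coord_mx i 'X)) => z z0 /=.
  rewrite pE; last exact: coord_mx_diag_group.
  rewrite det_coord_mx horner_curve; congr (ev _ _ / _).
  apply/matrixP => x y; rewrite !mxE hornerMn; congr (_ *+ _).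
  by case: eqP => _; rewrite ?hornerX ?hornerC.
(* The entries have different denominators; the largest exponent serves for all of them. *)
pose K' := \max_(ab : 'I_n * 'I_n) (kp ab).1.
exists K', (\matrix_(a, b) ((kp (a, b)).2 * 'X^(K' - (kp (a, b)).1))) => z z0.
rewrite (negbTE z0); apply/matrixP => a b; rewrite !mxE (kpP (a, b)) //=.
have le : ((kp (a, b)).1 <= K')%N by exact: leq_bigmax.
rewrite hornerM hornerXn mulrCA; congr (_ * _).
apply: (mulfI (expf_neq0 K' z0)); rewrite mulrA divff ?expf_neq0 // mul1r.
by rewrite -[in LHS](subnK le) exprD mulfK // expf_neq0.
Qed.

Lemma conjM_coord_mx r (i : 'I_r) (z : F[i]) :
  conjM (coord_mx i z) = coord_mx i (conjc z).
Proof.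
apply/matrixP => x y; rewrite !mxE rmorphMn; congr (_ *+ _).
by case: eqP => _ //; exact: conjc1.
Qed.

(** The isomorphism with the diagonal group is real, and the diagonal group is generated by its
    coordinate subgroups. On each of these c is an integral power of z, which commutes with
    conjugation. *)
Lemma eigenvector_real T c X : is_subgroup T -> is_split_torus T -> X != 0 ->
  eigenvector_of T c X -> forall t, T t -> c (conjM t) = conjc (c t).
Proof.
move=> Tsub [TR [r [phi [phim [psi [psim psiK phiK]]]]]] X0 TX t Tt.
have [phiT phiM phiR] := phim.
have phiJ A : diag_group F r A -> phi (conjM A) = conjM (phi A).
  move=> DA; have DA' : diag_group F r (conjM A).
    case: DA => AU /is_diag_mxP AD; split; first by rewrite map_unitmx.
    by apply/is_diag_mxP => x y xy; rewrite mxE AD // conjc0.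
  apply/matrixP => a b; rewrite [RHS]mxE; have [k [p pE]] := phiR a b.
  rewrite !pE // ev_real_conj.
  have -> : \det (conjM A) = conjc (\det A) by exact: det_map_mx.
  by rewrite [RHS]rmorphM /= fmorphV rmorphXn.
have [_ psiD _] : [/\ True, forall A, T A -> diag_group F r (psi A) & True].
  by case: psim.
have -> : t = phi (psi t) by rewrite phiK.
have [/= tU /diag_mxP[d tE]] := psiD t Tt.
have d0 i : d 0 i != 0.
  move: tU; rewrite tE unitmxE det_diag unitfE; apply: contraNneq => di0.
  by rewrite (bigD1 i) //= di0 mul0r.
rewrite tE diag_mx_prod.
have cphi1 : c (phi 1%:M) = 1.
  have T1 := phiT _ (diag_group1 r); have U1 := is_subgroup_unit Tsub T1.
  have := phiM _ _ (diag_group1 r) (diag_group1 r); rewrite mulmx1.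
  move/(congr1 (mulmx (invmx (phi 1%:M)))); rewrite mulVmx // mulKmx // => <-.
  exact: eigenvector_one TX.
(* Membership in the diagonal group is carried along because c is multiplicative only on T. *)
suff [] : [/\ diag_group F r (\big[@mulmx _ r r r/1%:M]_(i < r) coord_mx i (d 0 i)) &
   c (conjM (phi (\big[@mulmx _ r r r/1%:M]_(i < r) coord_mx i (d 0 i)))) =
   conjc (c (phi (\big[@mulmx _ r r r/1%:M]_(i < r) coord_mx i (d 0 i))))] by [].
elim/big_ind : _ => [|A B [DA HA] [DB HB]|i _].
- split; first exact: diag_group1.
  rewrite -phiJ; last exact: diag_group1.
  have -> : conjM (1%:M : 'M[F[i]]_r) = 1%:M.
    by apply/matrixP => x y; rewrite !mxE rmorph_nat.
  by rewrite cphi1 conjc1.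
- split; first exact: diag_groupM.
  have TJ C : diag_group F r C -> T (conjM (phi C)).
    by move=> DC; case: TR => TZ _; apply: zclosedR_conj => //; exact: phiT.
  rewrite phiM // conjM_mul (eigenvector_mul Tsub X0 TX); [|exact: TJ|exact: TJ].
  rewrite (eigenvector_mul Tsub X0 TX); [|exact: phiT|exact: phiT].
  by rewrite HA HB [RHS]rmorphM.
have z0 := d0 i; have z0' : conjc (d 0 i) != 0 by rewrite conjc_eq0.
have [j [k jk]] := eigenvector_cochar Tsub (coord_cocharP i phim) X0 TX.
have D1 := coord_mx_diag_group i z0; split => //.
rewrite -phiJ // conjM_coord_mx.
have := jk _ z0'; rewrite /coord_cochar (negbTE z0') => e'.
have := jk _ z0; rewrite /coord_cochar (negbTE z0) => /(congr1 (@conjc F)).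
rewrite [in RHS]rmorphM /= !rmorphXn /= e' => e.
by apply: (mulIf (expf_neq0 k z0')).
Qed.

End SplitTorus.
(** * Strongly orthogonal roots *)

Section StronglyOrthogonal.
Context (F : realType) (n : nat) (G T : set 'M[F[i]]_n).
Context (GR : alg_group_R G) (Tsub : is_subgroup T) (Tsplit : is_split_torus T).
Implicit Types (a b c : 'M[F[i]]_n -> F[i]) (X Y Z U V : 'M[F[i]]_n).

Let Gsub : is_subgroup G. Proof. by case: GR. Qed.

Lemma weight_bracket a b X Y : weight_space G T a X -> weight_space G T b Y ->
  weight_space G T (char_add a b) (bracket X Y).
Proof.
move=> [LX TX] [LY TY]; split; first exact: Lie_bracket.
move=> t Tt; rewrite Int_bracket ?(is_subgroup_unit Tsub) // TX // TY //.
rewrite /bracket -!scalemxAl -!scalemxAr !scalerA [b t * a t]mulrC.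
by rewrite -scalerBr.
Qed.

Lemma weight_conj c X : weight_space G T c X -> weight_space G T c (conjM X).
Proof.
move=> [LX TX]; split; first by apply: Lie_conj => //; case: GR.
(* The reality of c is deduced from a nonzero eigenvector, so X = 0 is treated apart. *)
have [->|X0] := eqVneq X 0.
  move=> t _; have -> : conjM (0 : 'M[F[i]]_n) = 0.
    by apply/matrixP => i j; rewrite !mxE conjc0.
  by rewrite /Int mulmx0 mul0mx scaler0.
move=> t Tt; have Tt' : T (conjM t).
  by case: Tsplit => -[TZ _] _; exact: zclosedR_conj.
rewrite -{1}[t]conjMK /Int -conjM_invmx -!conjM_mul -/(Int _ _) TX //.
rewrite (eigenvector_real Tsub Tsplit X0 TX Tt).
by apply/matrixP => i j; rewrite !mxE rmorphM /= conjcK.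
Qed.

Lemma characterD a b : character T a -> character T b -> character T (char_add a b).
Proof.
move=> [a0 an0 aM [ka [pa apE]]] [b0 bn0 bM [kb [pb bpE]]]; split.
- by move=> t Tt; rewrite /char_add a0 // mul0r.
- by move=> t Tt; rewrite /char_add mulf_neq0 ?an0 ?bn0.
- by move=> t u Tt Tu; rewrite /char_add aM // bM // mulrACA.
exists (ka + kb)%N, (pa * pb) => A TA.
rewrite /char_add apE // bpE // /ev !rmorphM /= exprD invfM.
by rewrite mulrACA.
Qed.

Lemma char_add0 a b : character T a -> character T b -> b <> char_opp a ->
  exists2 t, T t & char_add a b t != 1.
Proof.
move=> [a0 an0 _ _] [b0 _ _ _] ab; apply: contrapT => H; apply: ab.
apply/funext => t; rewrite /char_opp; have [Tt|Tt] := pselect (T t); last first.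
  (* Outside T both functions are 0, because 0^-1 = 0. *)
  by rewrite a0 // b0 // invr0.
apply: (mulfI (an0 t Tt)); rewrite divff ?an0 //.
by apply/eqP/negPn/negP => h; apply: H; exists t.
Qed.

(** A nonzero Z would make a + b a root; b <> -a rules out the trivial character, which is not a
    root. *)
Lemma weight_add0 a b Z : character T a -> character T b -> b <> char_opp a ->
  ~ root_set G T (char_add a b) -> weight_space G T (char_add a b) Z -> Z = 0.
Proof.
move=> ca cb ab nab wZ; apply: contrapT => Z0; apply: nab; split.
- exact: characterD.
- exact: char_add0.
- by exists Z => //; exact/eqP.
Qed.

(** s_a a = -a, because <a, a^vee> = 2: a(t l(a t)^-1) = a(t) a(t)^-2. *)
Lemma reflection_char a l m t :
  cochar T l -> (forall z, z != 0 -> a (l z) = z ^+ 2) ->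
  acts_as_reflection G T a l m -> character T a -> T t ->
  a (Int m t) = (a t)^-1.
Proof.
move=> [_ lT _ _] al [_ mE] [_ an0 aM _] Tt; rewrite mE //.
have [_ T1 TM TV] := Tsub.
have at0 := an0 _ Tt; have Tl := lT _ at0; have Tl' := TV _ Tl.
have a1 : a 1%:M = 1.
  by apply: (mulfI (an0 _ T1)); rewrite -aM // mulmx1 mulr1.
rewrite aM //; have -> : a (invmx (l (a t))) = (a t ^+ 2)^-1.
  apply: (mulfI (an0 _ Tl)); rewrite -aM // mulmxV ?(is_subgroup_unit Tsub) //.
  by rewrite a1 al // divff // expf_neq0.
by rewrite expr2 invfM mulrA divff // mul1r.
Qed.

(* The opposite of a root is regular because it is the composite of the root
   with the conjugation by a representative of its reflection. *)
Lemma character_opp a l : character T a -> is_coroot G T a l ->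
  character T (char_opp a).
Proof.
move=> ca [lc al [m rm]]; have [a0 an0 aM [k [p pE]]] := ca; split.
- by move=> t Tt; rewrite /char_opp a0 // invr0.
- by move=> t Tt; rewrite /char_opp invr_eq0 an0.
- by move=> t u Tt Tu; rewrite /char_opp aM // invfM.
have [[Gm mT] _] := rm; have mU := is_subgroup_unit Gsub Gm.
have [h hE] : polyfun (fun A => ev (mpoly.map_mpoly idfun p) (Int m A)).
  apply: polyfun_comp => i j; rewrite /Int.
  by apply: polyfun_mulmx => {i j}; [apply: polyfun_mulmx => //|];
     [exact: polyfun_mx_cst|exact: polyfun_entry|exact: polyfun_mx_cst].
exists k, h => A TA.
rewrite /char_opp -(reflection_char lc al rm ca TA) pE; last first.
  by rewrite -mT; exists A.
have -> : \det (Int m A) = \det A.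
  have dm0 : \det m != 0 by move: mU; rewrite unitmxE unitfE.
  by rewrite /Int !det_mulmx det_inv mulrAC divff ?mul1r.
rewrite hE; congr (ev _ _ / _); apply/mpoly.mpolyP => q.
by rewrite mpoly.mcoeff_map_mpoly.
Qed.

Lemma char_addC a b : char_add a b = char_add b a.
Proof. by apply/funext => t; rewrite /char_add mulrC. Qed.

Lemma char_oppK a : char_opp (char_opp a) = a.
Proof. by apply/funext => t; rewrite /char_opp invrK. Qed.


(** Each bracket lies in a weight space for a + b, a - b, b - a or -a - b. The first three vanish by
    hypothesis, b - a through the second orthogonality assumption; the last is carried by s_a to the
    weight a - b. *)
Lemma bracket_strongly_orthogonal a b Xa Ya Xb Yb :
  is_opposite G T a Xa Ya -> is_opposite G T b Xb Yb ->
  strongly_orthogonal G T a b -> strongly_orthogonal G T b a ->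
  forall U V, weight_space G T a U \/ weight_space G T (char_opp a) U ->
    weight_space G T b V \/ weight_space G T (char_opp b) V ->
    bracket U V = 0.
Proof.
move=> [[ca _ _] wXa Xa0 wYa [la [Ha [cra dHa _ _ bXYa]]]].
move=> [[cb _ _] wXb Xb0 wYb [lb [Hb [crb _ _ _ _]]]].
move=> [ab aob nab namb] [_ _ _ nbma].
have ca' := character_opp ca cra; have cb' := character_opp cb crb.
have PP U V : weight_space G T a U -> weight_space G T b V -> bracket U V = 0.
  by move=> wU wV; apply: (weight_add0 ca cb aob nab); exact: weight_bracket.
have PM Z : weight_space G T (char_add a (char_opp b)) Z -> Z = 0.
  apply: (weight_add0 ca cb') => // e; apply: ab.
  by rewrite -[b]char_oppK e char_oppK.
have MP U V : weight_space G T (char_opp a) U -> weight_space G T b V ->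
    bracket U V = 0.
  move=> wU wV; apply: (weight_add0 cb ca' _ nbma).
    by move=> e; apply: ab; rewrite -[b]char_oppK -e char_oppK.
  by rewrite char_addC; exact: weight_bracket.
have [lc al [m rm]] := cra.
(* <b, a^vee> = 0: X_b commutes with X_a and with its opposite, hence with their bracket
   da^vee(1). *)
have bl z : z != 0 -> b (la z) = 1.
  apply: (eigenvector_dcochar Tsub lc Xb0 _ dHa); first by case: wXb.
  have hX := bracket0_comm (PP _ _ wXa wXb).
  have hY := bracket0_comm (MP _ _ wYa wXb).
  rewrite -bXYa /bracket mulmxBl mulmxBr -!mulmxA hX hY !mulmxA hX hY.
  by [].
(* By [bl] the reflection fixes b, while it negates a. *)
have MM Z : weight_space G T (char_add (char_opp a) (char_opp b)) Z -> Z = 0.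
  move=> [LZ TZ]; have [[Gm mT] mE] := rm.
  have mU := is_subgroup_unit Gsub Gm.
  have mZ0 : Int m Z = 0.
    apply: PM; split; first exact: Lie_Int.
    rewrite -{1}mT => _ [t Tt <-]; have tU := is_subgroup_unit Tsub Tt.
    have -> : Int (Int m t) (Int m Z) = Int m (Int t Z).
      rewrite -Int_mul //; last by rewrite /Int !unitmx_mul mU tU unitmx_inv.
      have -> : Int m t *m m = m *m t by rewrite /Int mulmxKV.
      by rewrite Int_mul.
    rewrite TZ // Int_scale /char_add /char_opp.
    rewrite (reflection_char lc al rm ca Tt) (mE t Tt).
    have [_ an0 _ _] := ca; have [_ bn0 bM _] := cb; have [_ lT _ _] := lc.
    have [_ _ _ TV] := Tsub; have Tl := lT _ (an0 _ Tt).
    rewrite bM //; last exact: TV.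
    by rewrite (eigenvector_inv Tsub Xb0 (proj2 wXb) Tl) bl ?an0 // invr1 mulr1.
  by rewrite -(IntK Z mU) mZ0 /Int mulmx0 mul0mx.
move=> U V [wU|wU] [wV|wV]; [exact: PP| |exact: MP|].
  by apply: PM; exact: weight_bracket.
by apply: MM; exact: weight_bracket.
Qed.

End StronglyOrthogonal.
(** * Products of Cayley elements *)

Section CayleyProducts.
Context (F : realType) (n : nat) (G B0 T : set 'M[F[i]]_n)
  (Xs : ('M[F[i]]_n -> F[i]) -> 'M[F[i]]_n).
Implicit Types (A B : set ('M[F[i]]_n -> F[i])) (a b c : 'M[F[i]]_n -> F[i])
  (l : F[i] -> 'M[F[i]]_n) (g t M U V : 'M[F[i]]_n).

Definition root_vector a U : Prop :=
  weight_space G T a U \/ weight_space G T (char_opp a) U.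

(** Independence of the choice of mu rests on this form, which is the same for every mu. *)
Lemma is_g_opposite mu a g : is_g G B0 T Xs mu a g ->
  exists X Y (k : F[i]), is_opposite G T a X Y /\ g = expM (k *: (X + Y)).
Proof.
by move=> [_ [a' [m [X [Y [_ _ _ XY gE]]]]]]; exists X, Y; eexists; split; last exact: gE.
Qed.

Lemma is_g_prod_unit A g : is_g_prod G B0 T Xs A g -> g \in unitmx.
Proof.
move=> [s [mus [gs [_ AE gA ->]]]].
have {AE} sA a : a \in s -> A a by rewrite AE.
elim: s sA => [|a s IH] sA; first by rewrite big_nil unitmx1.
rewrite big_cons -mulmxE unitmx_mul IH ?andbT => [|b bs]; last first.
  by apply: sA; rewrite inE bs orbT.
have [X [Y [k [_ ->]]]] := is_g_opposite (gA a (sA a (mem_head _ _))).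
exact: expM_unit.
Qed.

Lemma is_g_prod_comm A g M : is_g_prod G B0 T Xs A g ->
  (forall a, A a -> forall U, root_vector a U -> M *m U = U *m M) ->
  M *m g = g *m M.
Proof.
move=> [s [mus [gs [_ AE gA ->]]]] MA.
have {AE} sA a : a \in s -> A a by rewrite AE.
elim: s sA => [|a s IH] sA; first by rewrite big_nil mulmx1 mul1mx.
have Aa := sA a (mem_head _ _).
rewrite big_cons -mulmxE mulmxA.
have [X [Y [k [[_ wX _ wY _] ->]]]] := is_g_opposite (gA a Aa).
have MXY : M *m (k *: (X + Y)) = (k *: (X + Y)) *m M.
  rewrite -scalemxAr -scalemxAl mulmxDr mulmxDl.
  by rewrite (MA a Aa X (or_introl wX)) (MA a Aa Y (or_intror wY)).
rewrite (expM_comm MXY) -mulmxA IH ?mulmxA // => b bs.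
by apply: sA; rewrite inE bs orbT.
Qed.

(** [is_g_prod] accepts any enumeration of A, so the members of A' may be listed first. The result
    is [g1 *m g2], not the given g, but every admissible product computes T_A. *)
Lemma is_g_prodD A A' g : A' `<=` A -> is_g_prod G B0 T Xs A g ->
  exists g1 g2, [/\ is_g_prod G B0 T Xs A' g1,
    is_g_prod G B0 T Xs (A `\` A') g2 & is_g_prod G B0 T Xs A (g1 *m g2)].
Proof.
move=> AA [s [mus [gs [us AE gA _]]]].
pose s1 := [seq a <- s | a \in A']; pose s2 := [seq a <- s | a \notin A'].
exists (\prod_(a <- s1) gs a), (\prod_(a <- s2) gs a); split.
- exists s1, mus, gs; split=> //; first exact: filter_uniq.
    apply/seteqP; split=> a /=.
      move=> A'a; rewrite mem_filter; apply/andP; split; first exact/mem_set.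
      by have := AA _ A'a; rewrite AE.
    by rewrite mem_filter => /andP[/set_mem].
  by move=> a A'a; apply: gA; exact: AA.
- exists s2, mus, gs; split=> //; first exact: filter_uniq.
    apply/seteqP; split=> a /=.
      move=> [Aa nA'a]; rewrite mem_filter; apply/andP; split; last by move: Aa; rewrite AE.
      by apply/negP => /set_mem.
    rewrite mem_filter => /andP[nA'a sa]; split; first by rewrite AE.
    by move=> A'a; move/negP: nA'a; apply; exact/mem_set.
  by move=> a [Aa _]; exact: gA.
have ps : perm_eq (s1 ++ s2) s by rewrite perm_filterC.
exists (s1 ++ s2), mus, gs; split=> //.
- by rewrite (perm_uniq ps).
- by rewrite AE; apply/seteqP; split=> a /=; rewrite (perm_mem ps).
- by rewrite big_cat.
Qed.

(** * Anti-invariant cocharacters under Cayley products *)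

Context (GR : alg_group_R G) (Tsub : is_subgroup T) (Tsplit : is_split_torus T).
Context (A A' : set ('M[F[i]]_n -> F[i])) (AA : A' `<=` A).
Context (SOS_A : is_SOS G T A) (gA : exists g, is_g_prod G B0 T Xs A g).

(** The coroot of a and the opposite vector come from the product whose existence [is_T] asserts,
    not from structure theory. *)
Lemma opposite_of_mem a : A a -> exists X Y, is_opposite G T a X Y.
Proof.
case: gA => g [s [mus [gs [_ _ gsA _]]]] Aa.
have [X [Y [k [XY _]]]] := is_g_opposite (gsA a Aa).
by exists X, Y.
Qed.

Lemma root_vector_comm a b U V : A a -> A b -> a <> b ->
  root_vector a U -> root_vector b V -> U *m V = V *m U.
Proof.
move=> Aa Ab ab rU rV; apply: bracket0_comm.
have [Xa [Ya aXY]] := opposite_of_mem Aa.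
have [Xb [Yb bXY]] := opposite_of_mem Ab.
have [_ so] := SOS_A.
apply: (bracket_strongly_orthogonal GR Tsub aXY bXY) rU rV; apply: so => //.
by move=> ba; apply: ab.
Qed.

Lemma root_vector_comm_prod a g U : (A `\` A') a -> is_g_prod G B0 T Xs A' g ->
  root_vector a U -> U *m g = g *m U.
Proof.
move=> [Aa nA'a] gP rU; apply: (is_g_prod_comm gP) => b A'b V rV.
apply: (root_vector_comm Aa (AA A'b) _ rU rV).
by move=> ab; apply: nA'a; rewrite ab.
Qed.

Context (T' : set 'M[F[i]]_n) (g : 'M[F[i]]_n).
Context (gP : is_g_prod G B0 T Xs A' g) (TE : T' = Int g @` T).

Let gU : g \in unitmx := is_g_prod_unit gP.

Lemma cochar_Int l : cochar T' l ->
  cochar T (fun z => if z == 0 then 0 else Int (invmx g) (l z)).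
Proof.
move=> [l0 lT lM [k [P lP]]]; split.
- by rewrite eqxx.
- move=> z z0; rewrite (negbTE z0); have := lT z z0; rewrite TE => -[t Tt <-].
  by rewrite IntK.
- move=> z w z0 w0; rewrite mulf_eq0 (negbTE z0) (negbTE w0) /= lM //.
  by rewrite /Int invmxK !mulmxA mulmxK.
exists k, (map_mx polyC (invmx g) *m P *m map_mx polyC g) => z z0.
rewrite (negbTE z0) lP // /Int invmxK -scalemxAr -scalemxAl; congr (_ *: _).
transitivity (evalmx (map_mx polyC (invmx g) *m P *m map_mx polyC g) z) => //.
by rewrite !evalmx_mul !evalmx_cst.
Qed.

(* A root vector X of a commutes with g and with its complex conjugate, so
   letting both sides of sigma(l) = - l act on X shows that the integer
   <a, g^-1 l> equals its opposite. *)
Lemma cochar_m1_root_eq1 a l z t : (A `\` A') a -> cochar_m1 T' l -> z != 0 ->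
  T t -> l z = Int g t -> a t = 1.
Proof.
move=> Aa [lc lm] z0 Tt lz.
have [X [Y [ra wX X0 _ _]]] := opposite_of_mem (proj1 Aa).
have cX : X *m g = g *m X by apply: (root_vector_comm_prod Aa gP); left.
(* [conjM X] is again a root vector of a, so it commutes with g; conjugate that relation. *)
have cX' : X *m conjM g = conjM g *m X.
  have := root_vector_comm_prod Aa gP (or_introl (weight_conj GR Tsub Tsplit wX)).
  by move/(congr1 (@conjM F n)); rewrite !conjM_mul conjMK.
have lc' := cochar_Int lc; set l' := (fun z => _) in lc'.
have [i [j ij]] := eigenvector_cochar Tsub lc' X0 (proj2 wX).
have l't : l' z = t by rewrite /l' (negbTE z0) lz IntK.
(* At the real point 2 the equation sigma(l) = - l reads conj(l 2) = (l 2)^-1. The exponents are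
   doubled because 2^i = a 2^j will be multiplied by its conjugate 2^i = a^-1 2^j. *)
have [two [two0 conj2 two_inj]] : exists x : F[i], [/\ x != 0, conjc x = x &
    forall i j, x ^+ (i + i) = x ^+ (j + j) -> i = j].
  exists 2%:R; split=> [||k m]; [by rewrite pnatr_eq0|exact: conjc_nat|].
  rewrite -!natrX => /eqP; rewrite eqr_nat eqn_exp2l // => /eqP.
  by rewrite !addnn => /double_inj.
have T2 : T (l' two) by case: lc' => _ h _ _; exact: h.
have l2 : l two = Int g (l' two).
  rewrite /l' (negbTE two0) -{1}[g]invmxK IntK ?unitmx_inv //.
have e1 : conjM (l two) = invmx (l two).
  have := congr1 (fun f => f two) lm; rewrite /cochar_sigma /cochar_opp.
  by rewrite conj2.
have gU' : conjM g \in unitmx by rewrite map_unitmx.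
(* To be applied with h = g and h = [conjM g]: as h fixes X, the conjugate [Int h u] acts on X as u
   does. *)
have actC u h : h \in unitmx -> X *m h = h *m X -> T u ->
    Int (Int h u) X = a u *: X.
  move=> hU hX Tu; have uU := is_subgroup_unit Tsub Tu.
  have hX' : invmx h *m X = X *m invmx h.
    by rewrite -[X in _ = X *m _](mulKmx hU) -hX !mulmxA mulmxK.
  rewrite {2}/Int.
  have -> : h *m u *m invmx h = (h *m u) *m invmx h by [].
  rewrite !Int_mul ?unitmx_mul ?hU ?unitmx_inv //.
  rewrite [Int (invmx h) X]Int_comm ?unitmx_inv // (proj2 wX) //.
  by rewrite Int_scale Int_comm.
have T2' : T (conjM (l' two)) by case: Tsplit => -[TZ _] _; exact: zclosedR_conj.
have TV2 : T (invmx (l' two)) by case: Tsub => _ _ _; apply.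
have u2 : l' two \in unitmx := is_subgroup_unit Tsub T2.
have e2 : conjc (a (l' two)) = (a (l' two))^-1.
  apply: (scaler_inj_neq0 X0).
  rewrite -(eigenvector_real Tsub Tsplit X0 (proj2 wX) T2) -(actC _ _ gU') //.
  rewrite -(eigenvector_inv Tsub X0 (proj2 wX) T2) -(actC _ _ gU) //.
  congr (Int _ X).
  have -> : Int (conjM g) (conjM (l' two)) = conjM (l two).
    by rewrite l2 /Int !conjM_mul conjM_invmx.
  rewrite e1 l2 /Int !invmx_mul ?unitmx_mul ?gU ?u2 ?unitmx_inv //.
  by rewrite invmxK mulmxA.
have f2 := ij two two0.
have f2' : two ^+ i = (a (l' two))^-1 * two ^+ j.
  have := congr1 (@conjc F) f2.
  by rewrite [in RHS]rmorphM /= !rmorphXn /= conj2 e2.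
have eij : i = j.
  have a0 : a (l' two) != 0.
    by apply/eqP => a0; move/eqP: f2; rewrite a0 mul0r expf_eq0 (negbTE two0) andbF.
  by apply: two_inj; rewrite !exprD {1}f2 f2' mulrACA divff // mul1r.
have := ij z z0; rewrite l't eij => e.
by apply: (mulIf (expf_neq0 j z0)); rewrite mul1r -e.
Qed.

Lemma cochar_m1_comm l z t g2 : cochar_m1 T' l -> z != 0 -> T t ->
  l z = Int g t -> is_g_prod G B0 T Xs (A `\` A') g2 -> t *m g2 = g2 *m t.
Proof.
move=> lm z0 Tt lz g2P; have tU := is_subgroup_unit Tsub Tt.
apply: (is_g_prod_comm g2P) => a Aa U rU.
have at1 := cochar_m1_root_eq1 Aa lm z0 Tt lz.
have IU : Int t U = U.
  by case: rU => -[_ ->] //; rewrite /char_opp at1 ?invr1 scale1r.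
by rewrite -{2}IU /Int mulmxKV.
Qed.

Lemma cochar_m1_Int_id l z g2 : cochar_m1 T' l -> z != 0 ->
  is_g_prod G B0 T Xs (A `\` A') g2 -> Int g2 (l z) = l z.
Proof.
move=> lm z0 g2P; have [[_ lT _ _] _] := lm.
have := lT z z0; rewrite TE => -[t Tt lz].
have g2U := is_g_prod_unit g2P.
have tg2 := cochar_m1_comm lm z0 Tt (esym lz) g2P.
have gg2 : g *m g2 = g2 *m g.
  apply: (is_g_prod_comm g2P) => a Aa U rU.
  exact: esym (root_vector_comm_prod Aa gP rU).
have ggV : invmx g *m g2 = g2 *m invmx g.
  by rewrite -[X in _ = X *m _](mulKmx gU) gg2 !mulmxA mulmxK.
apply: Int_comm => //; rewrite -lz /Int.
by rewrite !mulmxA -gg2 -[_ *m invmx g *m g2]mulmxA ggV !mulmxA -[_ *m t *m g2]mulmxA tg2 !mulmxA.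
Qed.

Lemma cochar_m1_sub TA l : cochar_m1 T' l ->
  (forall h, is_g_prod G B0 T Xs A h -> TA = Int h @` T) ->
  (exists2 g2, is_g_prod G B0 T Xs (A `\` A') g2 &
               is_g_prod G B0 T Xs A (g *m g2)) ->
  cochar_m1 TA l.
Proof.
move=> lm TAE [g2 g2P gg2P]; have [[l0 lT lM lP] ls] := lm; split=> //; split=> //.
move=> z z0; have := lT z z0; rewrite TE => -[t Tt lz].
rewrite (TAE _ gg2P); exists t => //.
have g2U := is_g_prod_unit g2P; rewrite Int_mul // [Int g2 t]Int_comm //.
by apply/esym; exact: (cochar_m1_comm lm z0 Tt (esym lz) g2P).
Qed.

End CayleyProducts.

Unset Implicit Arguments.

Theorem lemma5p1 (F : realType) (n : nat) (G B0 T0 : set 'M[F[i]]_n)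
    (Xs : ('M[F[i]]_n -> F[i]) -> 'M[F[i]]_n)
    (hG : alg_group_R G) (hss : is_semisimple G) (hsc : is_simply_connected G)
    (hspl : is_splitting G B0 T0 Xs)
    (A' A : set ('M[F[i]]_n -> F[i])) (hAA : A' `<=` A)
    (hA' : is_SOS G T0 A') (hA : is_SOS G T0 A)
    (hpos : A `<=` root_set B0 T0)
    (TA' TA : set 'M[F[i]]_n)
    (hTA' : is_T G B0 T0 Xs A' TA') (hTA : is_T G B0 T0 Xs A TA) :
  exists i : (F[i] -> 'M[F[i]]_n) -> (F[i] -> 'M[F[i]]_n),
    [/\ forall l, cochar_m1 TA' l -> cochar_m1 TA (i l),
        forall l1 l2, cochar_m1 TA' l1 -> cochar_m1 TA' l2 ->
          i (cochar_add l1 l2) = cochar_add (i l1) (i l2),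
        forall l1 l2, cochar_m1 TA' l1 -> cochar_m1 TA' l2 ->
          i l1 = i l2 -> l1 = l2 &
        forall phi, canonical_isos G B0 T0 Xs A' A TA' phi ->
          forall l, cochar_m1 TA' l ->
            forall z, z != 0 -> i l z = phi (l z)].
Proof.
have [_ Tsplit _ _ _] := hspl.
have Tsub : is_subgroup T0 by case: Tsplit => -[].
have [gA TAE] := hTA; have [h hP] := gA.
(* One decomposition fixes g' = [g1] for T_{A'}; the g defining an arbitrary canonical isomorphism
   need not be [g2]. *)
have [g1 [g2 [g1P g2P g12P]]] := is_g_prodD hAA hP.
have TE' := proj2 hTA' _ g1P.
exists id; split=> // [l lm|phi [g gP phiE] l lm z z0].
  apply: (cochar_m1_sub hG Tsub Tsplit hAA hA gA g1P TE' lm TAE).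
  by exists g2.
rewrite phiE; last by case: lm => -[_ lT _ _] _; exact: lT.
by rewrite (cochar_m1_Int_id hG Tsub Tsplit hAA hA gA g1P TE' lm z0 gP).
Qed.
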